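(* Let $n$ be a positive integer. There exist unbounded domains $D_1$ and $D_2$ in $\mathbb{C}^n$ such that the semigroups $E(D_1)$ and $E(D_2)$ are isomorphic, but there is no biholomorphic and no antibiholomorphic map from $D_1$ onto $D_2$.
   Context: For a domain $D$, $E(D)$ denotes the semigroup under composition of all holomorphic maps $D\to D$. *)

(* Defs.v *)
(* C = R[i] (complex numbers over an
   arbitrary realType R), C^n = 'rV[R[i]]_n with its canonical normed
   R[i]-module structure.  "Holomorphic" = complex (R[i]-linear) Frechet
   differentiability at every point of an open set. *)
From HB Require Import structures.
From mathcomp Require Import all_boot all_order all_algebra.
From mathcomp Require Import all_classical all_reals all_analysis.
From mathcomp Require Import complex.
Import Order.TTheory GRing.Theory Num.Theory numFieldNormedType.Exports.
Local Open Scope ring_scope.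
Local Open Scope classical_set_scope.

Set Implicit Arguments.
Unset Strict Implicit.
Unset Printing Implicit Defensive.

Section Defs.
Variables (R : realType) (n : nat).

Definition Cn : normedModType R[i] := 'rV[R[i]]_n.

Definition is_domain (D : set Cn) : Prop :=
  open D /\ connected D /\ D !=set0.

Definition unbounded (D : set Cn) : Prop := ~ bounded_set D.

Definition holomorphic_on (D : set Cn) (f : Cn -> Cn) : Prop :=
  forall z, D z -> differentiable f z.

Definition maps_into (D1 D2 : set Cn) (f : Cn -> Cn) : Prop :=
  forall z, D1 z -> D2 (f z).

(* membership in E(D): holomorphic self-map of D (only values on D matter) *)
Definition in_E (D : set Cn) (f : Cn -> Cn) : Prop :=
  holomorphic_on D f /\ maps_into D D f.

(* E(D1) and E(D2) are isomorphic semigroups (under composition).  Elements of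
   E(D) are maps D -> D, represented by functions Cn -> Cn up to equality on D;
   Phi is a well-defined bijective composition-preserving map on these classes. *)
Definition E_isomorphic (D1 D2 : set Cn) : Prop :=
  exists Phi : (Cn -> Cn) -> (Cn -> Cn),
    [/\ (forall f, in_E D1 f -> in_E D2 (Phi f)),
        (forall f g, in_E D1 f -> in_E D1 g ->
           (forall z, D1 z -> f z = g z) -> forall w, D2 w -> Phi f w = Phi g w),
        (forall f g, in_E D1 f -> in_E D1 g ->
           forall w, D2 w -> Phi (f \o g) w = (Phi f \o Phi g) w),
        (forall f g, in_E D1 f -> in_E D1 g ->
           (forall w, D2 w -> Phi f w = Phi g w) -> forall z, D1 z -> f z = g z)
      & (forall h, in_E D2 h -> exists2 f, in_E D1 f &
           forall w, D2 w -> Phi f w = h w)].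

Definition biholomorphic (D1 D2 : set Cn) (F : Cn -> Cn) : Prop :=
  holomorphic_on D1 F /\ maps_into D1 D2 F /\
  exists G : Cn -> Cn,
    [/\ holomorphic_on D2 G, maps_into D2 D1 G,
        (forall z, D1 z -> G (F z) = z) & (forall w, D2 w -> F (G w) = w)].

Definition conjv (z : Cn) : Cn := map_mx Num.conj z.

Definition antiholomorphic_on (D : set Cn) (f : Cn -> Cn) : Prop :=
  holomorphic_on D (conjv \o f).

Definition antibiholomorphic (D1 D2 : set Cn) (F : Cn -> Cn) : Prop :=
  antiholomorphic_on D1 F /\ maps_into D1 D2 F /\
  exists G : Cn -> Cn,
    [/\ antiholomorphic_on D2 G, maps_into D2 D1 G,
        (forall z, D1 z -> G (F z) = z) & (forall w, D2 w -> F (G w) = w)].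

End Defs.

(* Main.v *)
(* Let L(th) be the Gaussian integers together with one extra real point th, where
   th is irrational, and let D(th) be the set of points of C^n all of whose
   coordinates avoid L(th).  A holomorphic map f from C \ L(th1) to C \ L(th2) omits
   a 1-net, so Bloch's theorem gives |f'(z)| <= 200 / d(z, L(th1)).  Hence f grows
   at most logarithmically at the points of L(th1), they are removable, the extension
   has bounded derivative, and f is affine by Liouville.  If f is not constant, its
   inverse maps L(th2) into L(th1), and irrationality leaves only the identity when
   th1 = th2, and nothing when th2 = 2 th1.  Therefore every component of a
   holomorphic self-map of D(th) is a coordinate or a constant, so conjugation with
   any bijection of C taking L(th) to L(2 th), applied to each coordinate, is an
   isomorphism of E(D(th)) onto E(D(2 th)), whereas every holomorphic map from D(th)
   to D(2 th) is constant.

   Cauchy's estimate comes from a Goursat argument on Riemann sums over boundaries of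
   squares, without integrals. *)
Require Import Defs.
From HB Require Import structures.
From mathcomp Require Import all_boot all_order all_algebra.
From mathcomp Require Import all_classical all_reals all_analysis.
From mathcomp Require Import complex.
From mathcomp Require Import ring lra.
Import Order.TTheory GRing.Theory Num.Theory numFieldNormedType.Exports.
Import Normc.

Local Open Scope ring_scope.
Local Open Scope classical_set_scope.

Set Implicit Arguments.
Unset Strict Implicit.
Unset Printing Implicit Defensive.

Arguments normc : simpl never.

(** * Modulus and completeness *)

Section Modulus.
Variable R : realType.
Implicit Types (x y z : R[i]) (r : R).

(** The Gaussian integers alone would leave translations and rotations as automorphisms of the
    punctured plane; one irrational point destroys them. That point is real, so the lattice stays
    symmetric under conjugation and the antiholomorphic case reduces to the holomorphic one. Once
    only coordinates and constants survive, the semigroup sees nothing of the topology, which is why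
    a discontinuous bijection can induce an isomorphism.

    The factor 2 is chosen because an affine match of the two lattices would need
    [th = 2 * a * th + b], hence [1 = 2 * a] for an integer [a]. The window [1 / 4 <= th <= 3 / 8]
    keeps both [th] and [2 * th] at distance at least [1 / 4] from the Gaussian integers, which is
    the separation [5 * s] with [s = 1 / 20].

    A net of omitted values, rather than two of them, makes the derivative bound elementary: a large
    derivative would force the image to cover a disc of radius 1.

    All limits come from one shrinking lemma, [nested_limit]: it serves the mean value inequality,
    Goursat's lemma, the second derivative, Newton's iteration and Bloch's doubling argument. *)

Lemma normcD x y : normc (x + y) <= normc x + normc y.
Proof. exact: le_normcD. Qed.

Lemma normcN x : normc (- x) = normc x.
Proof. by case: x => a b; rewrite /normc /= !sqrrN. Qed.

Lemma normcB x y : normc (x - y) <= normc x + normc y.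
Proof. by rewrite -(normcN y) normcD. Qed.

Lemma normc_distC x y : normc (x - y) = normc (y - x).
Proof. by rewrite -normcN opprB. Qed.

Lemma normc_tri y x z : normc (x - z) <= normc (x - y) + normc (y - z).
Proof. by have := normcD (x - y) (y - z); rewrite addrA subrK. Qed.

Lemma normc_ge0 x : 0 <= normc x.
Proof. by case: x => a b; rewrite /normc sqrtr_ge0. Qed.

Lemma normc_gt0 x : (0 < normc x) = (x != 0).
Proof.
rewrite lt_neqAle normc_ge0 andbT eq_sym; congr (~~ _).
by apply/eqP/eqP => [/eq0_normc//|->]; rewrite normc0.
Qed.

Lemma normcR r : normc r%:C%C = `|r|.
Proof. by rewrite /normc /= expr0n /= addr0 sqrtr_sqr. Qed.

Lemma normc_sqr x : normc x ^+ 2 = complex.Re x ^+ 2 + complex.Im x ^+ 2.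
Proof. by case: x => a b; rewrite /normc /= sqr_sqrtr// addr_ge0 ?sqr_ge0. Qed.

Lemma ReB x y : complex.Re (x - y) = complex.Re x - complex.Re y.
Proof. by case: x; case: y. Qed.

Lemma ImB x y : complex.Im (x - y) = complex.Im x - complex.Im y.
Proof. by case: x; case: y. Qed.

Lemma normc_Re x : `|complex.Re x| <= normc x.
Proof.
by rewrite -(ler_pXn2r (n := 2)) ?nnegrE ?normc_ge0// normc_sqr real_normK ?num_real// lerDl sqr_ge0.
Qed.

Lemma normc_Im x : `|complex.Im x| <= normc x.
Proof.
by rewrite -(ler_pXn2r (n := 2)) ?nnegrE ?normc_ge0// normc_sqr real_normK ?num_real// lerDr sqr_ge0.
Qed.

Lemma normc_ReB x y : `|complex.Re x - complex.Re y| <= normc (x - y).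
Proof. by rewrite -ReB normc_Re. Qed.

Lemma normc_ImB x y : `|complex.Im x - complex.Im y| <= normc (x - y).
Proof. by rewrite -ImB normc_Im. Qed.

Lemma normc_ReIm x : normc x <= `|complex.Re x| + `|complex.Im x|.
Proof.
rewrite -(ler_pXn2r (n := 2)) ?nnegrE ?normc_ge0 ?addr_ge0// normc_sqr.
rewrite -[X in X + _]real_normK ?num_real// -[X in _ + X]real_normK ?num_real//.
have := normr_ge0 (complex.Re x); have := normr_ge0 (complex.Im x).
move: `|_| `|_| => a b; nra.
Qed.

Lemma normc_arbitrarily_small x : (forall e, 0 < e -> normc x <= e) -> x = 0.
Proof.
move=> h; apply/eqP; apply: contraT; rewrite -normc_gt0 => x0.
have := h (normc x / 2) ltac:(lra); lra.
Qed.

Lemma pow2_small (A e : R) : 0 < e -> exists n, A / 2 ^+ n < e.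
Proof.
move=> e0; exists (Num.bound (A / e)); rewrite ltr_pdivrMr ?exprn_gt0//.
by rewrite mulrC -ltr_pdivrMr// upper_nthrootP.
Qed.

End Modulus.

Section Nested.
Variable R : realType.
Implicit Types (x y z : R[i]).

(* Completeness of C in the shape of a shrinking argument: both the bisection
   proofs and the iterations that only survive as long as a "bad" object exists
   are instances. *)
Lemma nested_limit (T : Type) (ctr : T -> R[i]) (sz : T -> R) (bad : T -> Prop) :
  (forall t, bad t -> 0 <= sz t) ->
  (forall t, bad t -> exists t', [/\ bad t', sz t' <= sz t / 2
     & normc (ctr t' - ctr t) <= sz t]) ->
  forall t, bad t -> exists z, forall e, 0 < e -> exists t',
    [/\ bad t', sz t' < e & normc (z - ctr t') <= 2 * sz t'].
Proof.
move=> sz0 step t0 bt0.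
have [nx nxP] : {nx : T -> T & forall t, bad t -> [/\ bad (nx t), sz (nx t) <= sz t / 2
     & normc (ctr (nx t) - ctr t) <= sz t]}.
  apply: (@choice _ _ (fun t t' => bad t -> [/\ bad t', sz t' <= sz t / 2
     & normc (ctr t' - ctr t) <= sz t])) => t.
  by have [/step[t' ?]|nb] := pselect (bad t); [exists t'|exists t].
pose u n := iter n nx t0.
have ub n : bad (u n) by elim: n => //= n /nxP[].
have us n : sz (u n.+1) <= sz (u n) / 2 by case: (nxP _ (ub n)).
have uc n : normc (ctr (u n.+1) - ctr (u n)) <= sz (u n) by case: (nxP _ (ub n)).
have usp n : sz (u n) <= sz t0 / 2 ^+ n.
  elim: n => [|n IH]; first by rewrite expr0 divr1.
  apply: (le_trans (us n)); rewrite exprSr invfM mulrA; apply: ler_wpM2r IH; lra.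
(* Sizes at least halve, so each displacement is at most twice the drop in size, and the
   displacements telescope. *)
have udiff n k : normc (ctr (u (n + k)%N) - ctr (u n)) <= 2 * (sz (u n) - sz (u (n + k)%N)).
  elim: k => [|k IH]; first by rewrite addn0 !subrr normc0 mulr0.
  rewrite addnS; have := normc_tri (ctr (u (n + k)%N)) (ctr (u (n + k).+1)) (ctr (u n)).
  have := uc (n + k)%N; have := us (n + k)%N; lra.
have udist n m : normc (ctr (u m) - ctr (u n)) <= 2 * sz (u n) + 2 * sz (u m).
  have s0 k := sz0 _ (ub k).
  case/orP: (leq_total n m) => /subnKC <-.
    have := udiff n (m - n)%N; have := s0 (n + (m - n))%N; lra.
  rewrite normc_distC; have := udiff m (n - m)%N; have := s0 (m + (n - m))%N; lra.
(* For a real coordinate [p], the intervals of radius [2 * sz] about the centres meet pairwise; the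
   supremum of their left ends lies in all of them. *)
have realcase (p : R[i] -> R) : (forall x y, `|p x - p y| <= normc (x - y)) ->
    exists s, forall n, `|s - p (ctr (u n))| <= 2 * sz (u n).
  move=> pl; pose A := [set p (ctr (u n)) - 2 * sz (u n) | n in [set: nat]].
  have ubA m : ubound A (p (ctr (u m)) + 2 * sz (u m)).
    move=> _ [n _ <-]; have := pl (ctr (u n)) (ctr (u m)); have := udist m n.
    have := ler_norm (p (ctr (u n)) - p (ctr (u m))); lra.
  have A0 : A !=set0 by exists (p (ctr (u 0%N)) - 2 * sz (u 0%N)), 0%N.
  exists (sup A) => n; rewrite ler_norml; apply/andP; split.
    suff : p (ctr (u n)) - 2 * sz (u n) <= sup A by lra.
    by apply: ub_le_sup; [exists (p (ctr (u 0%N)) + 2 * sz (u 0%N)); exact: ubA | exists n].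
  have := ge_sup A0 (ubA n); lra.
have [a aP] := realcase _ (fun x y => normc_ReB x y).
have [b bP] := realcase _ (fun x y => normc_ImB x y).
have zP n : normc (Complex a b - ctr (u n)) <= 4 * sz (u n).
  apply: (le_trans (normc_ReIm _)); rewrite !ReB !ImB /=.
  have := aP n; have := bP n; lra.
exists (Complex a b) => e e0.
have usmall d : 0 < d -> exists n, sz (u n) < d.
  by move=> /(pow2_small (sz t0))[n hn]; exists n; exact: le_lt_trans (usp n) hn.
have [n hn] := usmall _ e0; exists (u n); split => //.
rewrite leNgt; apply/negP => hlt.
(* Adding the two coordinates only gives the factor 4. A detour through a much later centre costs
   [6 * sz (u m)] and recovers the factor 2. *)
have [m hm] := usmall ((normc (Complex a b - ctr (u n)) - 2 * sz (u n)) / 6) ltac:(lra).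
have := normc_tri (ctr (u m)) (Complex a b) (ctr (u n)).
have := zP m; have := udist n m; lra.
Qed.

End Nested.

(** * Complex derivatives and the mean value inequality *)

Section ComplexDerivative.
Variable R : realType.
Implicit Types (f g : R[i] -> R[i]) (z a b d h : R[i]).

Definition cderiv f z d := forall e : R, 0 < e -> exists2 r, 0 < r &
  forall h, normc h < r -> normc (f (z + h) - f z - d * h) <= e * normc h.

Definition cdiff f z := exists d, cderiv f z d.

Lemma cderiv_near f g z d : (exists2 r, 0 < r & forall h, normc h < r -> g (z + h) = f (z + h)) ->
  cderiv f z d -> cderiv g z d.
Proof.
move=> [r r0 hr] hf e /hf[s s0 hs]; exists (Num.min r s); first by rewrite lt_min r0.
move=> h; rewrite lt_min => /andP[h1 h2]; rewrite hr//.
have := hr 0; rewrite normc0 addr0 => -> //; exact: hs.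
Qed.

Lemma cderiv_ext f g z d : g =1 f -> cderiv f z d -> cderiv g z d.
Proof. by move=> gf; apply: cderiv_near; exists 1 => // h _; exact: gf. Qed.

Lemma cderiv_cst c z : cderiv (fun=> c) z 0.
Proof.
by move=> e e0; exists 1 => // h _; rewrite subrr mul0r subr0 normc0 mulr_ge0 ?normc_ge0 ?ltW.
Qed.

Lemma cderiv_id z : cderiv id z 1.
Proof.
move=> e e0; exists 1 => // h _.
by rewrite /= mul1r (addrC z) addrK subrr normc0 mulr_ge0 ?normc_ge0 ?ltW.
Qed.

Lemma cderiv_lip f z d : cderiv f z d -> exists2 r, 0 < r &
  forall h, normc h < r -> normc (f (z + h) - f z) <= (normc d + 1) * normc h.
Proof.
move=> /(_ 1 ltr01)[r r0 hr]; exists r => // h /hr hh.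
have -> : f (z + h) - f z = (f (z + h) - f z - d * h) + d * h by ring.
by apply: (le_trans (normcD _ _)); rewrite normcM mulrDl addrC lerD2l.
Qed.

Lemma cderiv_cont f z d : cderiv f z d -> forall e, 0 < e -> exists2 r, 0 < r &
  forall h, normc h < r -> normc (f (z + h) - f z) <= e.
Proof.
move=> /cderiv_lip[r r0 hr] e e0; have d0 : 0 < normc d + 1 by rewrite ltr_wpDl ?normc_ge0.
exists (Num.min r (e / (normc d + 1))); first by rewrite lt_min r0 divr_gt0.
move=> h; rewrite lt_min ltr_pdivlMr// => /andP[/hr h1 h2]; apply: (le_trans h1).
by rewrite mulrC ltW.
Qed.

Lemma cderivD f g z d d' : cderiv f z d -> cderiv g z d' -> cderiv (fun x => f x + g x) z (d + d').
Proof.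
move=> hf hg e e0; have [r r0 hr] := hf (e / 2) ltac:(lra).
have [s s0 hs] := hg (e / 2) ltac:(lra).
exists (Num.min r s); first by rewrite lt_min r0.
move=> h; rewrite lt_min => /andP[/hr h1 /hs h2].
have -> : f (z + h) + g (z + h) - (f z + g z) - (d + d') * h =
  (f (z + h) - f z - d * h) + (g (z + h) - g z - d' * h) by ring.
by apply: (le_trans (normcD _ _)); rewrite (splitr e) mulrDl lerD.
Qed.

Lemma cderivM f g z d d' : cderiv f z d -> cderiv g z d' ->
  cderiv (fun x => f x * g x) z (d * g z + f z * d').
Proof.
move=> hf hg e e0.
have [rc rc0 hrc] := cderiv_cont hg ltr01.
have kpos (x : R[i]) : 0 < normc x + 1 by rewrite ltr_wpDl ?normc_ge0.
pose A := normc (g z) + 1; pose B := normc (f z) + 1; pose D := normc d + 1.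
have A0 : 0 < A by apply: kpos.
have B0 : 0 < B by apply: kpos.
have D0 : 0 < D by apply: kpos.
have [r r0 hr] := hf (e / 3 / A) ltac:(by rewrite !divr_gt0 //).
have [s s0 hs] := hg (e / 3 / B) ltac:(by rewrite !divr_gt0 //).
have [t t0 ht] := cderiv_cont hg (e := e / 3 / D) ltac:(by rewrite !divr_gt0 //).
exists (Num.min (Num.min rc r) (Num.min s t)); first by rewrite !lt_min rc0 r0 s0 t0.
move=> h; rewrite !lt_min => /andP[/andP[/hrc h1 /hr h2] /andP[/hs h3 /ht h4]].
have -> : f (z + h) * g (z + h) - f z * g z - (d * g z + f z * d') * h =
  (f (z + h) - f z - d * h) * g (z + h) + f z * (g (z + h) - g z - d' * h)
  + d * h * (g (z + h) - g z) by ring.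
have n0 := @normc_ge0 R.
apply: (le_trans (normcD _ _)); apply: (le_trans (lerD (normcD _ _) (lexx _))).
rewrite !normcM.
have gA : normc (g (z + h)) <= A.
  by have := normcD (g (z + h) - g z) (g z); rewrite subrK /A; lra.
have e1 : normc (f (z + h) - f z - d * h) * normc (g (z + h)) <= e / 3 * normc h.
  apply: (le_trans (ler_pM (n0 _) (n0 _) h2 gA)).
  by rewrite mulrAC divfK ?gt_eqF.
have e2 : normc (f z) * normc (g (z + h) - g z - d' * h) <= e / 3 * normc h.
  have fB : normc (f z) <= B by rewrite /B lerDl.
  apply: (le_trans (ler_pM (n0 _) (n0 _) fB h3)).
  by rewrite mulrA (mulrC B) divfK ?gt_eqF.
have e3 : normc d * normc h * normc (g (z + h) - g z) <= e / 3 * normc h.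
  have dD : normc d <= D by rewrite /D lerDl.
  rewrite mulrAC; apply: ler_wpM2r => //.
  apply: (le_trans (ler_pM (n0 _) (n0 _) dD h4)).
  by rewrite (mulrC D) divfK ?gt_eqF.
lra.
Qed.

Lemma cderivV z : z != 0 -> cderiv (fun x => x^-1) z (- z ^- 2).
Proof.
move=> z0 e e0; have nz : 0 < normc z by rewrite normc_gt0.
pose m := normc z.
exists (Num.min (m / 2) (e * (m * m * m) / 2)).
  by rewrite lt_min !divr_gt0 ?mulr_gt0.
move=> h; rewrite lt_min => /andP[h1 h2].
have zh : m / 2 < normc (z + h).
  by have := normcB (z + h) h; rewrite addrK -/m; lra.
have zh0 : z + h != 0 by rewrite -normc_gt0; apply: lt_trans zh; rewrite divr_gt0.
have -> : (z + h)^-1 - z^-1 - - z ^- 2 * h = h * h / (z * z * (z + h)).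
  by field; apply/andP.
rewrite !normcM normcV !normcM -/m mulrAC; apply: ler_wpM2r; first exact: normc_ge0.
rewrite ler_pdivrMr; last by rewrite !mulr_gt0//; apply: lt_trans zh; rewrite divr_gt0.
apply: (le_trans (ltW h2)).
have -> : e * (m * m * m) / 2 = e * (m * m * (m / 2)) by rewrite !mulrA.
by rewrite ler_pM2l// ler_pM2l ?mulr_gt0// ltW.
Qed.

Lemma cderiv_affine f a b z d : cderiv f (a * z + b) d -> cderiv (fun x => f (a * x + b)) z (d * a).
Proof.
move=> hf e e0; have A0 : 0 < normc a + 1 by rewrite ltr_wpDl ?normc_ge0.
have [r r0 hr] := hf (e / (normc a + 1)) ltac:(by rewrite divr_gt0 //).
exists (r / (normc a + 1)); first by rewrite divr_gt0.
move=> h; rewrite ltr_pdivlMr// => hh.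
have -> : a * (z + h) + b = a * z + b + a * h by ring.
have ah : normc (a * h) <= normc h * (normc a + 1).
  by rewrite normcM mulrC ler_wpM2l ?normc_ge0// lerDl.
rewrite -mulrA; apply: (le_trans (hr _ (le_lt_trans ah hh))).
by rewrite mulrAC ler_pdivrMr// -mulrA ler_pM2l.
Qed.

Lemma cderiv_shift f s z d : cderiv f (z + s) d -> cderiv (fun x => f (x + s)) z d.
Proof.
move=> hf; rewrite -[d]mulr1; apply: cderiv_ext (cderiv_affine (a := 1) (b := s) _).
  by move=> x; rewrite mul1r.
by rewrite mul1r.
Qed.

Lemma cderivZ f c z d : cderiv f z d -> cderiv (fun x => c * f x) z (c * d).
Proof. by move=> hf; have := cderivM (cderiv_cst c z) hf; rewrite mul0r add0r. Qed.

Lemma cderivB f g z d d' : cderiv f z d -> cderiv g z d' -> cderiv (fun x => f x - g x) z (d - d').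
Proof.
move=> hf hg; have := cderivD hf (cderivZ (-1) hg); rewrite mulN1r.
by apply: cderiv_ext => x; rewrite mulN1r.
Qed.

Lemma cderiv_unique f z d d' : cderiv f z d -> cderiv f z d' -> d = d'.
Proof.
move=> h1 h2; apply/subr0_eq/normc_arbitrarily_small => e e0.
have [r r0 hr] := h1 (e / 2) ltac:(lra); have [s s0 hs] := h2 (e / 2) ltac:(lra).
pose t := Num.min r s / 2; have t0 : 0 < t by rewrite /t divr_gt0// lt_min r0 s0.
have nt : normc (t%:C)%C = t by rewrite normcR gtr0_norm.
have tm : t < Num.min r s by rewrite /t; have := t0; rewrite /t; lra.
move: tm; rewrite lt_min -nt => /andP[/hr a1 /hs a2].
have := normcB (f (z + (t%:C)%C) - f z - d' * (t%:C)%C) (f (z + (t%:C)%C) - f z - d * (t%:C)%C).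
have -> : f (z + (t%:C)%C) - f z - d' * (t%:C)%C - (f (z + (t%:C)%C) - f z - d * (t%:C)%C)
  = (d - d') * (t%:C)%C by ring.
rewrite normcM; rewrite nt in a1 a2 * => a3.
rewrite -(ler_pM2r t0); lra.
Qed.

Lemma cdiff_cst c z : cdiff (fun=> c) z.
Proof. by exists 0; exact: cderiv_cst. Qed.

Lemma cdiff_id z : cdiff id z.
Proof. by exists 1; exact: cderiv_id. Qed.

Lemma cdiffB f g z : cdiff f z -> cdiff g z -> cdiff (fun x => f x - g x) z.
Proof. by move=> [d h] [d' h']; exists (d - d'); exact: cderivB. Qed.

Lemma cdiffM f g z : cdiff f z -> cdiff g z -> cdiff (fun x => f x * g x) z.
Proof. by move=> [d h] [d' h']; eexists; exact: (cderivM h h'). Qed.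

End ComplexDerivative.

Section MeanValue.
Variable R : realType.
Implicit Types (f df : R[i] -> R[i]) (a b c z : R[i]) (M r : R).

(** Bisection: if the chord is too long, so is the chord over one of the halves. The parameters
    close in on a [tau] where the derivative contradicts the excess slope. *)
Lemma cderiv_mvt f df a b M :
  (forall t : R, 0 <= t <= 1 -> cderiv f (a + (t%:C)%C * (b - a)) (df (a + (t%:C)%C * (b - a)))) ->
  (forall t : R, 0 <= t <= 1 -> normc (df (a + (t%:C)%C * (b - a))) <= M) ->
  normc (f b - f a) <= M * normc (b - a).
Proof.
move=> hd hM; rewrite leNgt; apply/negP => hlt.
pose p (t : R) := a + (t%:C)%C * (b - a).
have pa : p 0 = a by rewrite /p mul0r addr0.
have pb : p 1 = b by rewrite /p mul1r addrC subrK.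
set N := normc (f b - f a) in hlt; set L := normc (b - a) in hlt.
have L0 : 0 < L.
  rewrite lt_neqAle normc_ge0 andbT; apply/eqP => /esym L0.
  move: hlt; rewrite /N L0 mulr0.
  by have /subr0_eq -> := eq0_normc L0; rewrite subrr normc0 ltxx.
pose bad (t : R * R) := [/\ 0 <= t.1, t.1 < t.2, t.2 <= 1
  & N * (t.2 - t.1) <= normc (f (p t.2) - f (p t.1))].
have bad01 : bad (0, 1) by split => //=; rewrite pa pb subr0 mulr1.
clear pa pb.
have [|||z hz] := @nested_limit R _ (fun t : R * R => (t.1%:C)%C) (fun t => t.2 - t.1) bad _ _ (0, 1).
- by move=> [s t] [/= *]; lra.
- move=> [s t] [/= s0 st t1 hb]; pose m := (s + t) / 2.
  have := normc_tri (f (p m)) (f (p t)) (f (p s)) => tri.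
  have [hl|hl] := lerP (N * (m - s)) (normc (f (p m) - f (p s))).
    exists (s, m); split => /=; last by rewrite subrr normc0; lra.
      by split => //=; rewrite /m; lra.
    by rewrite /m; lra.
  exists (m, t); split => /=; last by rewrite -rmorphB normcR /= ger0_norm /m; lra.
    split => //=; try by rewrite /m; lra.
    have -> : t - m = (t - s) - (m - s) by ring.
    by rewrite mulrBr; lra.
  by rewrite /m; lra.
- exact: bad01.
pose tau := complex.Re z.
have hz' e : 0 < e -> exists s t, [/\ bad (s, t), t - s < e & `|tau - s| <= 2 * (t - s)].
  move=> /hz[[s t] [h1 h2 h3]]; exists s, t; split => //.
  by apply: le_trans h3; exact: (normc_ReB z (s%:C)%C).
have tau01 : 0 <= tau <= 1.
  apply/andP; split.
    rewrite leNgt; apply/negP => h; have [s [t [[/= ? ? ? _] h1]]] := hz' (- tau / 4) ltac:(lra).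
    rewrite ler_norml => /andP[? ?]; lra.
  rewrite leNgt; apply/negP => h; have [s [t [[/= ? ? ? _] h1]]] := hz' ((tau - 1) / 4) ltac:(lra).
  rewrite ler_norml => /andP[? ?]; lra.
(* [tau] may lie outside [[s, t]], so both ends are compared with it, at distances up to
   [3 * (t - s)] and [2 * (t - s)]. The errors add up to [5 * e0 * L * (t - s)], half of the
   excess. *)
pose e0 := (N - M * L) / (10 * L).
have e00 : 0 < e0 by rewrite divr_gt0 ?subr_gt0 ?mulr_gt0.
have e0L : e0 * L * 10 = N - M * L by rewrite /e0; field; rewrite gt_eqF.
have [r r0 hr] := hd _ tau01 _ e00.
have [s [t [[/= s0 st t1 hb] ts hs]]] := hz' (r / (3 * L)) ltac:(by rewrite divr_gt0 ?mulr_gt0).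
rewrite ltr_pdivlMr ?mulr_gt0// in ts.
have ps u : p u = p tau + ((u - tau)%:C)%C * (b - a) by rewrite /p rmorphB /=; ring.
have nu u : normc (((u - tau)%:C)%C * (b - a)) = `|u - tau| * L by rewrite normcM normcR.
have hs' : `|s - tau| <= 2 * (t - s) by rewrite distrC.
have ht' : `|t - tau| <= 3 * (t - s).
  have -> : t - tau = (t - s) + (s - tau) by ring.
  apply: (le_trans (ler_normD _ _)); rewrite (ger0_norm (x := t - s)); lra.
have bnd u : `|u - tau| <= 3 * (t - s) ->
    normc (f (p u) - f (p tau) - df (p tau) * (((u - tau)%:C)%C * (b - a))) <= e0 * (`|u - tau| * L).
  move=> hu; rewrite -nu (ps u); apply: hr; rewrite nu; apply: le_lt_trans ts.
  have -> : (t - s) * (3 * L) = 3 * (t - s) * L by ring.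
  by rewrite ler_pM2r.
have b1 := bnd _ ht'; have b2 := bnd s ltac:(lra).
have := normcD (f (p t) - f (p tau) - df (p tau) * (((t - tau)%:C)%C * (b - a))
  - (f (p s) - f (p tau) - df (p tau) * (((s - tau)%:C)%C * (b - a)))) (df (p tau) * (((t - s)%:C)%C * (b - a))).
have -> : f (p t) - f (p tau) - df (p tau) * (((t - tau)%:C)%C * (b - a))
  - (f (p s) - f (p tau) - df (p tau) * (((s - tau)%:C)%C * (b - a))) + (df (p tau) * (((t - s)%:C)%C * (b - a)))
  = f (p t) - f (p s) by rewrite !rmorphB /=; ring.
rewrite (normcM (df _)) normcM normcR -/L (ger0_norm (x := t - s)); last by lra.
move=> tot.
have := normcB (f (p t) - f (p tau) - df (p tau) * (((t - tau)%:C)%C * (b - a)))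
  (f (p s) - f (p tau) - df (p tau) * (((s - tau)%:C)%C * (b - a))) => tot2.
have eL0 : 0 < e0 * L by rewrite mulr_gt0.
have q1 : e0 * (`|t - tau| * L) <= e0 * L * (3 * (t - s)).
  by rewrite mulrA mulrAC; apply: ler_wpM2l => //; exact: ltW.
have q2 : e0 * (`|s - tau| * L) <= e0 * L * (2 * (t - s)).
  by rewrite mulrA mulrAC; apply: ler_wpM2l; [exact: ltW | lra].
have q3 : normc (df (p tau)) * ((t - s) * L) <= M * ((t - s) * L).
  by apply: ler_wpM2r; [rewrite mulr_ge0; lra | exact: hM].
have q4 : 0 < e0 * L * (t - s) by rewrite mulr_gt0 ?subr_gt0.
have q5 : M * ((t - s) * L) = (M * L) * (t - s) by ring.
have q6 : N * (t - s) = (M * L) * (t - s) + 10 * (e0 * L * (t - s)).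
  transitivity ((M * L + e0 * L * 10) * (t - s)); last by ring.
  by congr (_ * _); lra.
lra.
Qed.

Lemma disc_segment c r a b (t : R) : normc (a - c) < r -> normc (b - c) < r -> 0 <= t <= 1 ->
  normc (a + (t%:C)%C * (b - a) - c) < r.
Proof.
move=> ha hb /andP[t0 t1].
have -> : a + (t%:C)%C * (b - a) - c = ((1 - t)%:C)%C * (a - c) + (t%:C)%C * (b - c).
  by rewrite rmorphB rmorph1 /=; ring.
apply: (le_lt_trans (normcD _ _)); rewrite !normcM !normcR ger0_norm ?subr_ge0// ger0_norm//.
move: ha hb; set A := normc (a - c); set B := normc (b - c) => hA hB.
have [h|h] := lerP A B.
  apply: le_lt_trans hB; rewrite -subr_ge0.
  have -> : B - ((1 - t) * A + t * B) = (1 - t) * (B - A) by ring.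
  by rewrite mulr_ge0 ?subr_ge0.
apply: le_lt_trans hA; rewrite -subr_ge0.
have -> : A - ((1 - t) * A + t * B) = t * (A - B) by ring.
by rewrite mulr_ge0// subr_ge0 ltW.
Qed.

Lemma cderiv_mvt_disc f df c r M a b : (forall z, normc (z - c) < r -> cderiv f z (df z)) ->
  (forall z, normc (z - c) < r -> normc (df z) <= M) ->
  normc (a - c) < r -> normc (b - c) < r -> normc (f b - f a) <= M * normc (b - a).
Proof.
by move=> hd hM ha hb; apply: (cderiv_mvt (df := df)) => t ht; [apply: hd|apply: hM];
  exact: disc_segment.
Qed.

End MeanValue.

(** * Riemann sums over squares *)

Section SquareSums.
Variable R : realType.
Implicit Types (f g : R[i] -> R[i]) (c p v w z : R[i]) (n : nat).

(* Riemann sum of [g] along the segment from [p - v] to [p + v], cut into [3 ^ n]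
   equal pieces with their midpoints as tags; ternary subdivision keeps the
   centre of a square at the centre of a subsquare. *)
Fixpoint segsum n g p v : R[i] :=
  if n is m.+1 then
    segsum m g (p - 2 * (v / 3)) (v / 3) + segsum m g p (v / 3)
    + segsum m g (p + 2 * (v / 3)) (v / 3)
  else 2 * v * g p.

Lemma segsumB n g1 g2 p v :
  segsum n (fun z => g1 z - g2 z) p v = segsum n g1 p v - segsum n g2 p v.
Proof. by elim: n p v => [|n IH] p v /=; [|rewrite !IH]; ring. Qed.

Lemma segsumZ n c g p v : segsum n (fun z => c * g z) p v = c * segsum n g p v.
Proof. by elim: n p v => [|n IH] p v /=; [|rewrite !IH]; ring. Qed.

Lemma segsum_ext n g1 g2 p v : g1 =1 g2 -> segsum n g1 p v = segsum n g2 p v.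
Proof. by move=> e; elim: n p v => [|n IH] p v /=; rewrite ?e // !IH. Qed.

(** Midpoint tags make the sum exact on affine functions, so the linear part drops out of Goursat's
    argument without error. *)
Lemma segsum_affine n a b p v : segsum n (fun z => a * z + b) p v = 2 * v * (a * p + b).
Proof. by elim: n p v => [|n IH] p v //=; rewrite !IH; field. Qed.

Lemma segsum_scale n l g p v :
  segsum n g (l * p) (l * v) = l * segsum n (fun z => g (l * z)) p v.
Proof.
elim: n p v => [|n IH] p v /=; first by ring.
have -> : l * v / 3 = l * (v / 3) by ring.
have -> : l * p - 2 * (l * (v / 3)) = l * (p - 2 * (v / 3)) by ring.
have -> : l * p + 2 * (l * (v / 3)) = l * (p + 2 * (v / 3)) by ring.
by rewrite !IH; ring.
Qed.

Lemma third_in (t : R) : `|t| <= 1 ->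
  [/\ `|(t - 2) / 3| <= 1, `|t / 3| <= 1 & `|(t + 2) / 3| <= 1].
Proof. by rewrite !ler_norml => /andP[? ?]; split; apply/andP; split; lra. Qed.

Lemma segsum_opp n g p v : segsum n g p (- v) = - segsum n g p v.
Proof.
elim: n p v => [|n IH] p v /=; first by ring.
have -> : - v / 3 = - (v / 3) by ring.
rewrite !IH mulrN opprK; ring.
Qed.

(** Here [s] is the fraction of the segment taken by a piece, which makes the hypothesis stable
    under subdivision. With [phi] the modulus this is the length bound; with [phi] minus the
    imaginary part it bounds the sum of [z^-1] from below. *)
Lemma segsum_subadditive (phi : R[i] -> R) n g p v (K : R) :
  (forall x y, phi (x + y) <= phi x + phi y) ->
  (forall s t : R, 0 < s -> `|t| <= 1 ->
     phi (2 * ((s%:C)%C * v) * g (p + (t%:C)%C * v)) <= s * K) ->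
  phi (segsum n g p v) <= K.
Proof.
move=> phiD; elim: n p v K => [|n IH] p v K hK.
  by have := hK 1 0 ltr01; rewrite normr0 rmorph0 rmorph1 mul0r addr0 !mul1r => /(_ ler01).
have c3 (t q : R) : ((t / 3 + q)%:C)%C = (t%:C)%C / 3 + (q%:C)%C.
  by rewrite rmorphD rmorphM fmorphV rmorph_nat.
have n2 : ((2:R)%:C)%C = 2 :> R[i] by rewrite rmorph_nat.
have q2 : ((2 / 3 : R)%:C)%C = 2 / 3 :> R[i] by rewrite rmorphM fmorphV !rmorph_nat.
have qm2 : ((- (2 / 3) : R)%:C)%C = - (2 / 3) :> R[i] by rewrite rmorphN rmorphM fmorphV !rmorph_nat.
have s3 (s : R) : ((s / 3)%:C)%C = (s%:C)%C / 3 by rewrite rmorphM fmorphV rmorph_nat.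
have -> : K = K / 3 + K / 3 + K / 3 by field.
have sub (q : R) : (forall t : R, `|t| <= 1 -> `|t / 3 + q| <= 1) ->
    phi (segsum n g (p + (q%:C)%C * v) (v / 3)) <= K / 3.
  move=> hq; apply: IH => s t s0 /hq ht.
  have := hK (s / 3) _ ltac:(by rewrite divr_gt0) ht.
  rewrite c3 s3 (mulrDl _ _ v).
  have -> : (s%:C)%C / 3 * v = (s%:C)%C * (v / 3) by ring.
  have -> : p + ((t%:C)%C / 3 * v + (q%:C)%C * v) = p + (q%:C)%C * v + (t%:C)%C * (v / 3) by ring.
  by have -> : s / 3 * K = s * (K / 3) by ring.
have b1 := sub (- (2 / 3)) ltac:(by move=> t /third_in[]; rewrite mulrBl).
have b2 := sub 0 ltac:(by move=> t /third_in[]; rewrite addr0).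
have b3 := sub (2 / 3) ltac:(by move=> t /third_in[_ _]; rewrite mulrDl).
rewrite [segsum _ _ _ _]/=; apply: (le_trans (phiD _ _)); apply: lerD.
  apply: (le_trans (phiD _ _)); apply: lerD.
    have -> : p - 2 * (v / 3) = p + - (2 / 3) * v by ring.
    by rewrite -qm2.
  by move: b2; rewrite rmorph0 mul0r addr0.
have -> : p + 2 * (v / 3) = p + 2 / 3 * v by ring.
by rewrite -q2.
Qed.

Lemma segsum_bound n g p v (M : R) :
  (forall t : R, `|t| <= 1 -> normc (g (p + (t%:C)%C * v)) <= M) ->
  normc (segsum n g p v) <= 2 * normc v * M.
Proof.
move=> hM; apply: segsum_subadditive => [|s t s0 /hM ht]; first exact: normcD.
have n2 : normc (2 : R[i]) = 2.
  by rewrite -[2]/(2%:R) -(rmorph_nat (real_complex R)) normcR ger0_norm.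
rewrite !normcM n2 normcR gtr0_norm//.
have -> : 2 * (s * normc v) * normc (g (p + (t%:C)%C * v)) =
  s * (2 * normc v * normc (g (p + (t%:C)%C * v))) by ring.
by rewrite ler_pM2l// ler_wpM2l// mulr_ge0 ?normc_ge0.
Qed.

(** Counterclockwise boundary sum for the square of centre [c] whose half-side is the complex vector
    [v]; the top and left sides are run backwards. *)
Definition sqsum n g c v : R[i] :=
  segsum n g (c - 'i%C * v) v + segsum n g (c + v) ('i%C * v)
  - segsum n g (c + 'i%C * v) v - segsum n g (c - v) ('i%C * v).

Lemma sqsumB n g1 g2 c v : sqsum n (fun z => g1 z - g2 z) c v = sqsum n g1 c v - sqsum n g2 c v.
Proof. by rewrite /sqsum !segsumB; ring. Qed.

Lemma sqsumZ n a g c v : sqsum n (fun z => a * g z) c v = a * sqsum n g c v.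
Proof. by rewrite /sqsum !segsumZ; ring. Qed.

Lemma sqsum_ext n g1 g2 c v : g1 =1 g2 -> sqsum n g1 c v = sqsum n g2 c v.
Proof. by move=> e; rewrite /sqsum !(segsum_ext _ _ _ e). Qed.

Lemma sqsum_affine n a b c v : sqsum n (fun z => a * z + b) c v = 0.
Proof. by rewrite /sqsum !segsum_affine; ring. Qed.

(** The bound [3 / 2] stands in for the square root of 2, the ratio of half-diagonal to half-side;
    every later [3 / 2] comes from here. *)
Lemma normc_i_real (t : R) : 1 <= normc ((t%:C)%C + 'i%C) /\ 1 <= normc ((t%:C)%C - 'i%C)
  /\ (`|t| <= 1 -> normc ((t%:C)%C + 'i%C) <= 3 / 2 /\ normc ((t%:C)%C - 'i%C) <= 3 / 2).
Proof.
have e (b : R) : b ^+ 2 = 1 -> normc (Complex t b) ^+ 2 = t ^+ 2 + 1.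
  by move=> b1; rewrite normc_sqr /= b1.
have -> : (t%:C)%C + 'i%C = Complex t 1 :> R[i] by congr Complex; rewrite ?addr0 ?add0r.
have -> : (t%:C)%C - 'i%C = Complex t (-1) :> R[i] by congr Complex; rewrite /= ?subr0 ?add0r.
have e1 := e 1 (expr1n _ _).
have e2 := e (-1) ltac:(by rewrite sqrrN expr1n).
have := sqr_ge0 t; have := normc_ge0 (Complex t 1); have := normc_ge0 (Complex t (-1)).
move=> h1 h2 h3; split; [|split].
- by rewrite -(ler_pXn2r (n := 2)) ?nnegrE// e1 expr1n lerDr.
- by rewrite -(ler_pXn2r (n := 2)) ?nnegrE// e2 expr1n lerDr.
- move=> t1; have t2 : t ^+ 2 <= 1 by rewrite -real_normK ?num_real// expr_le1.
  by split; rewrite -(ler_pXn2r (n := 2)) ?nnegrE ?divr_ge0// ?e1 ?e2; lra.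
Qed.

Lemma sqsum_bound n g c v (M : R) :
  (forall z, normc v <= normc (z - c) <= 3 / 2 * normc v -> normc (g z) <= M) ->
  normc (sqsum n g c v) <= 8 * normc v * M.
Proof.
move=> hM.
have ni : normc ('i%C : R[i]) = 1.
  by rewrite /normc /= expr0n /= expr1n add0r sqrtr1.
have key (s : R[i]) (u : R[i]) : normc s = 1 -> 1 <= normc u <= 3 / 2 -> normc (g (c + s * u * v)) <= M.
  move=> s1 /andP[u1 u2]; apply: hM; rewrite addrC addKr !normcM s1 mul1r.
  by rewrite ler_peMl ?normc_ge0//= ler_wpM2r ?normc_ge0.
have mi2 : normc (- 'i%C : R[i]) = 1 by rewrite normcN.
have b1 : normc (segsum n g (c - 'i%C * v) v) <= 2 * normc v * M.
  apply: segsum_bound => t /(normc_i_real t).2.2[_ h].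
  have -> : c - 'i%C * v + (t%:C)%C * v = c + 1 * ((t%:C)%C - 'i%C) * v by ring.
  by apply: key; rewrite ?normc1// h (normc_i_real t).2.1.
have b3 : normc (segsum n g (c + 'i%C * v) v) <= 2 * normc v * M.
  apply: segsum_bound => t /(normc_i_real t).2.2[h _].
  have -> : c + 'i%C * v + (t%:C)%C * v = c + 1 * ((t%:C)%C + 'i%C) * v by ring.
  by apply: key; rewrite ?normc1// h (normc_i_real t).1.
have nv : normc ('i%C * v) = normc v by rewrite normcM ni mul1r.
have ii : 'i%C * 'i%C = -1 :> R[i] by rewrite -expr2 sqr_i.
have b2 : normc (segsum n g (c + v) ('i%C * v)) <= 2 * normc v * M.
  rewrite -nv; apply: segsum_bound => t /(normc_i_real t).2.2[_ h].
  have -> : c + v + (t%:C)%C * ('i%C * v) = c + 'i%C * ((t%:C)%C - 'i%C) * v.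
    by rewrite mulrBr ii; ring.
  by apply: key; rewrite // h (normc_i_real t).2.1.
have b4 : normc (segsum n g (c - v) ('i%C * v)) <= 2 * normc v * M.
  rewrite -nv; apply: segsum_bound => t /(normc_i_real t).2.2[h _].
  have -> : c - v + (t%:C)%C * ('i%C * v) = c + 'i%C * ((t%:C)%C + 'i%C) * v.
    by rewrite mulrDr ii; ring.
  by apply: key; rewrite // h (normc_i_real t).1.
clear key ii; rewrite /sqsum; apply: (le_trans (normcB _ _)).
apply: (le_trans (lerD (normcB _ _) (lexx _))).
apply: (le_trans (lerD (lerD (normcD _ _) (lexx _)) (lexx _))).
lra.
Qed.

(** Centres of the nine subsquares, measured in half-sides [v / 3]. The offset 0 gives a concentric
    subsquare, which is what isolates a puncture at the centre. *)
Definition subsquares : seq R[i] :=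
  [seq (k%:C)%C + 'i%C * (l%:C)%C | k <- [:: -2; 0; 2], l <- [:: -2; 0; 2]].

Lemma complex_pair (k l : R) : Complex k l = (k%:C)%C + 'i%C * (l%:C)%C.
Proof. exact: complexE. Qed.

Lemma subsquares_norm x : x \in subsquares -> normc x <= 3 /\ (x != 0 -> 2 <= normc x).
Proof.
move=> hx; suff [h1 h2] : normc x ^+ 2 <= 9 /\ (x != 0 -> 4 <= normc x ^+ 2).
  have n0 := normc_ge0 x; split; last move=> /h2 h.
    by rewrite -(ler_pXn2r (n := 2)) ?nnegrE//; lra.
  by rewrite -(ler_pXn2r (n := 2)) ?nnegrE//; lra.
case/allpairsP: hx => -[k l] /= [hk hl ->].
rewrite -complex_pair.
rewrite normc_sqr /= eq_complex /=.
move: hk hl; rewrite !inE => /or3P[] /eqP -> /or3P[] /eqP ->; rewrite ?eqxx /=;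
  by split; [lra | rewrite // => _; lra].
Qed.

Lemma uniq_subsquares : uniq subsquares.
Proof.
have u3 : uniq [:: -2; 0; 2 : R].
  by rewrite /= !inE !negb_or -!andbA; apply/and4P; split=> //; apply/eqP; lra.
apply: allpairs_uniq => // -[k l] [k' l'] _ _ /= e.
by have := e; rewrite -!complex_pair => -[-> ->].
Qed.

Lemma subsquares0 : 0 \in subsquares.
Proof.
apply/allpairsP; exists (0, 0); split; rewrite ?inE ?eqxx ?orbT//=.
by rewrite rmorph0 mulr0 addr0.
Qed.

(** The identity is exact: a side at level [n.+1] is three sums at level [n], and each of the twelve
    inner edges occurs with both signs. *)
Lemma sqsum_split n g c v :
  sqsum n.+1 g c v = \sum_(x <- subsquares) sqsum n g (c + x * (v / 3)) (v / 3).
Proof.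
set w := v / 3.
have vw : v = 3 * w by rewrite /w; field.
pose h (k l : R) := segsum n g (c + ((k%:C)%C + 'i%C * (l%:C)%C) * w) w.
pose e (k l : R) := segsum n g (c + ((k%:C)%C + 'i%C * (l%:C)%C) * w) ('i%C * w).
have C1 (r : R) : ((r + 1)%:C)%C = (r%:C)%C + 1 by rewrite rmorphD rmorph1.
have C2 (r : R) : ((r - 1)%:C)%C = (r%:C)%C - 1 by rewrite rmorphB rmorph1.
have cell k l : sqsum n g (c + ((k%:C)%C + 'i%C * (l%:C)%C) * w) w
    = h k (l - 1) + e (k + 1) l - h k (l + 1) - e (k - 1) l.
  by rewrite /sqsum /h /e C1 C2 C1 C2; congr (_ + _ - _ - _); congr (segsum _ _ _ _); ring.
rewrite /subsquares /allpairs /= !big_cons big_nil !cell {cell}.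
have -> : -2 - 1 = -3 :> R by ring.
have -> : -2 + 1 = -1 :> R by ring.
have -> : 0 - 1 = -1 :> R by ring.
have -> : 0 + 1 = 1 :> R by ring.
have -> : 2 - 1 = 1 :> R by ring.
have -> : 2 + 1 = 3 :> R by ring.
have -> : sqsum n.+1 g c v = (h (-2) (-3) + h 0 (-3) + h 2 (-3)) + (e 3 (-2) + e 3 0 + e 3 2)
   - (h (-2) 3 + h 0 3 + h 2 3) - (e (-3) (-2) + e (-3) 0 + e (-3) 2).
  have m2 : ((-2:R)%:C)%C = -2 :> R[i] by rewrite rmorphN rmorph_nat.
  have m3 : ((-3:R)%:C)%C = -3 :> R[i] by rewrite rmorphN rmorph_nat.
  have n2 : ((2:R)%:C)%C = 2 :> R[i] by rewrite rmorph_nat.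
  have n3 : ((3:R)%:C)%C = 3 :> R[i] by rewrite rmorph_nat.
  have iv : 'i%C * v / 3 = 'i%C * w by rewrite -mulrA.
  rewrite /sqsum /h /e [segsum n.+1 _ _ _]/= [segsum n.+1 _ _ _]/= [segsum n.+1 _ _ _]/=
    [segsum n.+1 _ _ _]/= iv -/w m2 m3 n2 n3 rmorph0.
  by congr (_ + _ + _ + (_ + _ + _) - (_ + _ + _) - (_ + _ + _)); congr (segsum _ _ _ _);
    rewrite vw; ring.
move: (h) (e) => H K; ring.
Qed.

End SquareSums.

(** * Goursat's lemma and Cauchy's estimate *)

Section Cauchy.
Variable R : realType.
Implicit Types (f g : R[i] -> R[i]) (c v w z a : R[i]) (n : nat) (A e : R).

Definition eventually_le (u : nat -> R[i]) A := exists N, forall n, (N <= n)%N -> normc (u n) <= A.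

Lemma eventually_le_sum (s : seq R[i]) (u : R[i] -> nat -> R[i]) A :
  (forall x, x \in s -> eventually_le (u x) A) ->
  eventually_le (fun n => \sum_(x <- s) u x n) ((size s)%:R * A).
Proof.
elim: s => [|x s IH] hs.
  by exists 0%N => n _; rewrite big_nil normc0 mul0r.
have [N hN] := hs x (mem_head _ _).
have [M hM] := IH ltac:(by move=> y ys; apply: hs; rewrite inE ys orbT).
exists (maxn N M) => n; rewrite geq_max => /andP[/hN h1 /hM h2].
rewrite big_cons; apply: (le_trans (normcD _ _)).
by rewrite /= -[(size s).+1]add1n natrD mulrDl mul1r lerD.
Qed.

Lemma eventually_leS u A : eventually_le (fun n => u n.+1) A -> eventually_le u A.
Proof. by move=> [N hN]; exists N.+1 => -[//|n]; exact: hN. Qed.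

Lemma normc_third v : normc (v / 3) = normc v / 3.
Proof.
rewrite normcM normcV; congr (_ / _).
by rewrite -[3]/(3%:R) -(rmorph_nat (real_complex R)) normcR ger0_norm.
Qed.

(** A sum exceeding [eta] times the squared half-side passes this defect to one of the nine
    subsquares. At the limit point the affine approximation sums to zero and the remainder is too
    small. *)
Lemma goursat g c v e : v != 0 -> 0 < e ->
  (forall z, normc (z - c) <= 3 / 2 * normc v -> cdiff g z) ->
  eventually_le (fun n => sqsum n g c v) e.
Proof.
move=> v0 e0 hg.
have nv : 0 < normc v by rewrite normc_gt0.
pose eta := e / normc v ^+ 2.
have eta0 : 0 < eta by rewrite divr_gt0// exprn_gt0.
have -> : e = eta * normc v ^+ 2 by rewrite /eta divfK// gt_eqF// exprn_gt0.
pose bad (t : R[i] * R[i]) := [/\ 0 < normc t.2,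
  normc (t.1 - c) + 3 / 2 * normc t.2 <= 3 / 2 * normc v
  & ~ eventually_le (fun n => sqsum n g t.1 t.2) (eta * normc t.2 ^+ 2)].
apply: contrapT => hbad.
have bad0 : bad (c, v) by split => //=; rewrite subrr normc0 add0r.
have [|||z hz] := @nested_limit R _ (fun t : R[i] * R[i] => t.1) (fun t => normc t.2) bad _ _ (c, v).
- by move=> t _; exact: normc_ge0.
- move=> [p w] [/= w0 hin hb].
  have [h|/existsNP[x /not_implyP[xin hx]]] := pselect (forall x, x \in subsquares R ->
    eventually_le (fun n => sqsum n g (p + x * (w / 3)) (w / 3)) (eta * normc (w / 3) ^+ 2)).
    exfalso; apply: hb; apply: eventually_leS.
    have [N hN] := eventually_le_sum h; exists N => n /hN; rewrite sqsum_split => h1.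
    apply: (le_trans h1); rewrite normc_third /=.
    by rewrite le_eqVlt; apply/orP; left; apply/eqP; field.
  have [x3 _] := subsquares_norm xin.
  have xw : normc (x * (w / 3)) <= normc w.
    by rewrite normcM normc_third mulrA ler_pdivrMr// mulrC ler_wpM2l// ltW.
  exists (p + x * (w / 3), w / 3); split => /=.
  + split => //=; first by rewrite normc_third divr_gt0.
    have -> : p + x * (w / 3) - c = (p - c) + x * (w / 3) by ring.
    have := normcD (p - c) (x * (w / 3)).
    rewrite normc_third; move: hin xw; lra.
  + by rewrite normc_third; lra.
  + by rewrite addrC addKr.
- exact: bad0.
have zin : normc (z - c) <= 3 / 2 * normc v.
  rewrite leNgt; apply/negP => hlt.
  have [[p w] [/= [/= w0 hin _] hs hd]] := hz ((normc (z - c) - 3 / 2 * normc v) / 4) ltac:(lra).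
  have := normc_tri p z c; lra.
have [d hd] := hg _ zin.
(* [28 = 8 * (7 / 2)]: the length factor of [sqsum_bound] times the distance [(3 / 2 + 2) * normc w]
   from the boundary to [z]. *)
have [r r0 hr] := hd (eta / 28) ltac:(lra).
have [[p w] [/= [/= w0 _ hb] hs hdist]] := hz (r / 4) ltac:(lra).
apply: hb; exists 0%N => n _.
rewrite -[sqsum _ _ _ _](subr0) -(sqsum_affine n d (g z - d * z) p w) -sqsumB.
have -> : eta * normc w ^+ 2 = 8 * normc w * (eta / 8 * normc w) by field.
apply: sqsum_bound => x /andP[_ hx].
have xz : normc (x - z) <= 7 / 2 * normc w.
  have := normc_tri p x z; have := normc_distC z p; lra.
have xr : normc (x - z) < r by lra.
have := hr _ xr; rewrite (addrC z) subrK => hh.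
have -> : g x - (d * x + (g z - d * z)) = g x - g z - d * (x - z) by ring.
apply: (le_trans hh).
have : eta / 28 * normc (x - z) <= eta / 28 * (7 / 2 * normc w) by rewrite ler_pM2l//; lra.
by move=> /le_trans; apply; rewrite le_eqVlt; apply/orP; left; apply/eqP; field.
Qed.

(** The eight outer subsquares fall under [goursat]: their centres are at least [2 / 3 * normc v]
    from [c], and the discs needed there have radius only [normc v / 2]. *)
Lemma sqsum_punctured_step g c v A e : v != 0 -> 0 < e ->
  (forall z, z != c -> normc (z - c) <= 3 / 2 * normc v -> cdiff g z) ->
  eventually_le (fun n => sqsum n g c (v / 3)) A ->
  eventually_le (fun n => sqsum n g c v) (A + e).
Proof.
move=> v0 e0 hg [N0 hN0].
have nv : 0 < normc v by rewrite normc_gt0.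
have [N hN] : eventually_le
    (fun n => \sum_(x <- [seq x <- subsquares R | x != 0]) sqsum n g (c + x * (v / 3)) (v / 3))
    ((size [seq x <- subsquares R | x != 0])%:R * (e / 9)).
  apply: eventually_le_sum => x; rewrite mem_filter => /andP[x0 /subsquares_norm[x3 /(_ x0) x2]].
  apply: goursat; [by rewrite -normc_gt0 normc_third divr_gt0|by rewrite divr_gt0|].
  have nx : normc (x * (v / 3)) = normc x * (normc v / 3) by rewrite normcM normc_third.
  have nx1 : 2 / 3 * normc v <= normc (x * (v / 3)).
    by rewrite nx; have := ler_wpM2r (x := normc v / 3) ltac:(lra) x2; lra.
  have nx2 : normc (x * (v / 3)) <= normc v.
    by rewrite nx; have := ler_wpM2r (x := normc v / 3) ltac:(lra) x3; lra.
  move=> z; rewrite normc_third => hz.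
  have hz2 : normc (z - c) <= normc (x * (v / 3)) + 3 / 2 * (normc v / 3).
    have := normcD (z - (c + x * (v / 3))) (x * (v / 3)).
    have -> : z - (c + x * (v / 3)) + x * (v / 3) = z - c by ring.
    lra.
  apply: hg; last by lra.
  rewrite -subr_eq0 -normc_gt0.
  have := normcB (z - c) (z - (c + x * (v / 3))).
  have -> : z - c - (z - (c + x * (v / 3))) = x * (v / 3) by ring.
  lra.
exists (maxn N0 N).+1 => -[//|n]; rewrite ltnS geq_max => /andP[/hN0 h0 /hN h1].
rewrite sqsum_split (bigD1_seq 0 (subsquares0 R) (uniq_subsquares R)) /= mul0r addr0.
rewrite -(big_filter _ (fun x => x != 0)).
apply: (le_trans (normcD _ _)); apply: lerD => //; apply: (le_trans h1).
have : ((size [seq x <- subsquares R | x != 0])%:R : R) <= 9.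
  by rewrite ler_nat size_filter; apply: (leq_trans (count_size _ _)).
by move=> h; have := ler_wpM2r (x := e / 9) ltac:(lra) h; lra.
Qed.

(** Passing to concentric squares costs arbitrarily little, and on a tiny square the growth
    [o(1 / |z - c|)] beats the perimeter. *)
Lemma goursat_punctured g c v e : v != 0 -> 0 < e ->
  (forall z, z != c -> normc (z - c) <= 3 / 2 * normc v -> cdiff g z) ->
  (forall eta, 0 < eta -> exists2 r, 0 < r &
     forall z, z != c -> normc (z - c) < r -> normc (z - c) * normc (g z) <= eta) ->
  eventually_le (fun n => sqsum n g c v) e.
Proof.
move=> v0 e0 hg hsmall.
have [r r0 hr] := hsmall (e / 16) ltac:(lra).
(* The final square contributes [e / 2]. The slack [e'] is universally quantified because every
   passage to the inner square consumes half of it. *)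
suff key k w : w != 0 -> normc w <= normc v -> normc w / 2 ^+ k < r / 2 -> forall e', 0 < e' ->
    eventually_le (fun n => sqsum n g c w) (e / 2 + e').
  have [k hk] := pow2_small (normc v) (e := r / 2) ltac:(lra).
  by rewrite (splitr e); apply: key hk _ _ => //; lra.
elim: k w => [|k IH] w w0 wv hw e' e'0.
  have nw : 0 < normc w by rewrite normc_gt0.
  exists 0%N => n _; apply: (@le_trans _ _ (e / 2)); last by lra.
  have -> : e / 2 = 8 * normc w * (e / 16 / normc w) by field; rewrite gt_eqF.
  apply: sqsum_bound => z /andP[z1 z2].
  have zc : z != c by rewrite -subr_eq0 -normc_gt0; lra.
  rewrite expr0 divr1 in hw.
  have h := hr _ zc ltac:(lra); rewrite ler_pdivlMr//.
  apply: le_trans h; rewrite mulrC ler_wpM2r ?normc_ge0//.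
have nw : 0 < normc w by rewrite normc_gt0.
have -> : e / 2 + e' = (e / 2 + e' / 2) + e' / 2 by field.
apply: sqsum_punctured_step => //; first by lra.
  by move=> z zc hz; apply: hg => //; apply: (le_trans hz); lra.
apply: IH; last by lra.
- by rewrite -normc_gt0 normc_third; lra.
- by rewrite normc_third; lra.
- rewrite normc_third; apply: le_lt_trans hw; rewrite exprS invfM.
  have : 0 < (2 ^+ k : R)^-1 by rewrite invr_gt0 exprn_gt0.
  by move: (_^-1) => q q0; rewrite mulrA ler_pM2r//; lra.
Qed.

End Cauchy.

Section CauchyEstimate.
Variable R : realType.
Implicit Types (f g df : R[i] -> R[i]) (a d v w z : R[i]) (n : nat) (M r e : R).

Lemma sqsum_rot n g : sqsum n g 0 1 =
  segsum n g (- 'i%C) 1 + 'i%C * segsum n (fun z => g ('i%C * z)) (- 'i%C) 1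
  - segsum n (fun z => g (- 1 * z)) (- 'i%C) 1
  - 'i%C * segsum n (fun z => g (- 'i%C * z)) (- 'i%C) 1.
Proof.
have ii : 'i%C * 'i%C = -1 :> R[i] by rewrite -expr2 sqr_i.
have h2 := segsum_scale n 'i%C g (- 'i%C) 1.
have h3 := segsum_scale n (-1) g (- 'i%C) (-1).
have h4 := segsum_scale n (- 'i%C) g (- 'i%C) (-1).
rewrite mulrN ii opprK mulr1 in h2.
rewrite segsum_opp !mulrNN !mul1r in h3.
rewrite segsum_opp !mulrNN ii mulr1 in h4.
by rewrite /sqsum mulr1 !add0r h2 h3 h4.
Qed.

(** Turning the bottom side by a fourth root of unity [u] multiplies its sum by [u^-1], and the four
    roots add up to zero. *)
Lemma sqsum_inv_sqr n : sqsum n (fun z => z^-1 * z^-1) 0 (1 : R[i]) = 0.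
Proof.
have ii : 'i%C * 'i%C = -1 :> R[i] by rewrite -expr2 sqr_i.
rewrite sqsum_rot.
have e (u : R[i]) : segsum n (fun z => (u * z)^-1 * (u * z)^-1) (- 'i%C) 1 =
    (u * u)^-1 * segsum n (fun z => z^-1 * z^-1) (- 'i%C) 1.
  by rewrite -segsumZ; apply: segsum_ext => z; rewrite !invfM; ring.
by rewrite !e !mulrNN ii !mulr1 invrN invr1; ring.
Qed.

Lemma sqsum_inv n : sqsum n (fun z => z^-1) 0 (1 : R[i]) = 4 * segsum n (fun z => z^-1) (- 'i%C) 1.
Proof.
have i0 : 'i%C != 0 :> R[i] by rewrite eq_complex /= oner_eq0 andbF.
rewrite sqsum_rot.
have e (u : R[i]) : segsum n (fun z => (u * z)^-1) (- 'i%C) 1 =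
    u^-1 * segsum n (fun z => z^-1) (- 'i%C) 1.
  by rewrite -segsumZ; apply: segsum_ext => z; rewrite invfM.
rewrite !e !invrN invr1 !mulNr mulrN mulrA divff//; ring.
Qed.

(** A quarter of the winding integral of [z^-1]; a lower bound replaces the value of pi. On the
    bottom side the imaginary part is [1 / (t ^+ 2 + 1)], at least [1 / 2] over a length 2. *)
Lemma segsum_inv_ge1 n : 1 <= normc (segsum n (fun z => z^-1) (- 'i%C) (1 : R[i])).
Proof.
apply: le_trans (normc_Im _); apply: le_trans (ler_norm _).
rewrite -[X in X <= _]opprK lerNl.
apply: (segsum_subadditive (phi := fun x => - complex.Im x)).
  by move=> [a b] [c d] /=; rewrite opprD.
move=> s t s0 t1; rewrite !mulr1.
have t2 : t ^+ 2 <= 1 by rewrite -real_normK ?num_real// expr_le1.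
have tp : 0 < t ^+ 2 + 1 by rewrite ltr_wpDl ?sqr_ge0.
have -> : (- 'i%C + (t%:C)%C)^-1 = Complex (t / (t ^+ 2 + 1)) (1 / (t ^+ 2 + 1)) :> R[i].
  have -> : - 'i%C + (t%:C)%C = Complex t (-1) :> R[i].
    by apply/eqP; rewrite eq_complex /= oppr0 add0r addr0 !eqxx.
  have nz : Complex t (-1) != 0 :> R[i] by rewrite eq_complex /= oppr_eq0 oner_eq0 andbF.
  apply: (mulfI nz); rewrite divff//; apply/eqP; rewrite eq_complex /=.
  by apply/andP; split; apply/eqP; field; rewrite gt_eqF.
have -> : 2 * (s%:C)%C = ((2 * s)%:C)%C :> R[i] by rewrite rmorphM rmorph_nat.
rewrite /= mul0r addr0 mulrN1 lerN2 mulrA mulr1 ler_pdivlMr//; nra.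
Qed.

(** The quotient [(f z - f 0 - d * z) / z ^+ 2] is [o(1 / |z|)] at 0, so its sums become small. The
    [f 0] term vanishes exactly, the [d] term has modulus at least [4 * normc d], and the [f] term
    is at most [8 * M]. *)
Lemma cauchy_estimate1 f d M : cderiv f 0 d ->
  (forall z, normc z <= 3 / 2 -> cdiff f z) ->
  (forall z, 1 <= normc z <= 3 / 2 -> normc (f z) <= M) -> normc d <= 2 * M.
Proof.
move=> hd hdf hM; rewrite leNgt; apply/negP => hlt.
have zV z : z != 0 -> cdiff (fun x => x^-1) z.
  by move=> z0; exists (- z ^- 2); exact: cderivV.
pose e := 4 * (normc d - 2 * M); have e0 : 0 < e by rewrite mulr_gt0// subr_gt0.
have [N hN] : eventually_le (fun n => sqsum n (fun z => (f z - f 0 - d * z) * (z^-1 * z^-1)) 0 1) (e / 2).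
  apply: goursat_punctured; rewrite ?oner_eq0 ?divr_gt0//.
    move=> z z0; rewrite subr0 normc1 mulr1 => hz.
    apply: (cdiffM (f := fun z => f z - f 0 - d * z)); last by apply: cdiffM; exact: zV.
    apply: (cdiffB (f := fun z => f z - f 0)); first by apply: cdiffB; [exact: hdf|exact: cdiff_cst].
    by apply: cdiffM; [exact: cdiff_cst | exact: cdiff_id].
  move=> eta eta0; have [r r0 hr] := hd _ eta0; exists r => // z z0; rewrite subr0 => /hr.
  rewrite add0r => h; have nz : 0 < normc z by rewrite normc_gt0.
  rewrite !normcM !normcV; move: h; move: (normc (_ - _)) => x h.
  by rewrite mulrCA mulVKf ?gt_eqF// ler_pdivrMr.
have := hN N (leqnn N).
have -> : sqsum N (fun z => (f z - f 0 - d * z) * (z^-1 * z^-1)) 0 1 =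
    sqsum N (fun z => f z * (z^-1 * z^-1)) 0 1 - d * (4 * segsum N (fun z => z^-1) (- 'i%C) 1).
  transitivity (sqsum N (fun z => f z * (z^-1 * z^-1)) 0 1
      - sqsum N (fun z => f 0 * (z^-1 * z^-1)) 0 1 - sqsum N (fun z => d * z^-1) 0 1).
    rewrite -!sqsumB; apply: sqsum_ext => z.
    (* The convention [0^-1 = 0] keeps the pointwise identity true at the singularity. *)
    by have [->|z0] := eqVneq z 0; [rewrite invr0; ring | field].
  by rewrite !sqsumZ sqsum_inv_sqr mulr0 subr0 sqsum_inv.
have b1 : normc (sqsum N (fun z => f z * (z^-1 * z^-1)) 0 1) <= 8 * normc (1 : R[i]) * M.
  apply: sqsum_bound => z; rewrite subr0 normc1 mulr1 => /andP[z1 z2].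
  have := hM z; rewrite z1 z2 => /(_ isT) h.
  rewrite !normcM !normcV; apply: le_trans h.
  rewrite -invfM ler_piMr ?normc_ge0// invf_le1 ?mulr_gt0//; nra.
have s1 := segsum_inv_ge1 N; rewrite normc1 mulr1 in b1.
set s := segsum _ _ _ _ in s1 *; set q := sqsum _ _ _ _ in b1 *.
have := normcB q (q - d * (4 * s)); rewrite subKr !normcM.
have -> : normc (4 : R[i]) = 4.
  by rewrite -[4]/(4%:R) -(rmorph_nat (real_complex R)) normcR ger0_norm.
have : normc d * 1 <= normc d * normc s by rewrite ler_wpM2l ?normc_ge0.
rewrite /e in e0 *; lra.
Qed.

Lemma cauchy_estimate f a d r M : 0 < r -> cderiv f a d ->
  (forall z, normc (z - a) <= 3 / 2 * r -> cdiff f z) ->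
  (forall z, r <= normc (z - a) <= 3 / 2 * r -> normc (f z) <= M) -> normc d <= 2 * M / r.
Proof.
move=> r0 hd hdf hM; rewrite ler_pdivlMr//.
have nr : normc (r%:C)%C = r by rewrite normcR gtr0_norm.
have -> : normc d * r = normc (d * (r%:C)%C) by rewrite normcM nr.
have ez z : normc ((r%:C)%C * z + a - a) = r * normc z by rewrite addrK normcM nr.
apply: (@cauchy_estimate1 (fun z => f ((r%:C)%C * z + a))).
- by apply: cderiv_affine; rewrite mulr0 add0r.
- move=> z hz; have [|d' hd'] := hdf ((r%:C)%C * z + a).
    by rewrite ez (mulrC _ r) ler_wpM2l// ltW.
  by exists (d' * (r%:C)%C); exact: cderiv_affine.
- move=> z /andP[z1 z2]; apply: hM; rewrite ez (mulrC _ r) ler_wpM2l ?(ltW r0)// andbT.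
  by rewrite ler_peMr// ltW.
Qed.

End CauchyEstimate.

(** * Second derivatives and removable singularities *)

Section HolomorphicDerivative.
Variable R : realType.
Implicit Types (f g df : R[i] -> R[i]) (c d u v w z : R[i]) (M r e : R).

Lemma cdiff_choice f (P : R[i] -> Prop) : (forall z, P z -> cdiff f z) ->
  exists df, forall z, P z -> cderiv f z (df z).
Proof.
move=> h; have [df hdf] := @choice _ _ (fun z d => P z -> cderiv f z d) ltac:(move=> z;
  by have [/h[d hd]|np] := pselect (P z); [exists d|exists 0]).
by exists df.
Qed.

(** Cauchy's estimate for [u] sent to [f (u + z) - f (u + w)], a function which the mean value
    inequality bounds by [M * normc (z - w)]. *)
Lemma deriv_lipschitz f df c r M z w : 0 < r ->
  (forall x, normc (x - c) < 2 * r -> cderiv f x (df x)) ->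
  (forall x, normc (x - c) < 2 * r -> normc (df x) <= M) ->
  normc (z - c) < r -> normc (w - c) < r ->
  normc (df z - df w) <= 4 * M / r * normc (z - w).
Proof.
move=> r0 hd hM hz hw.
have dist u v : normc (u - 0) <= 3 / 2 * (r / 2) -> normc (v - c) < r -> normc (u + v - c) < 2 * r.
  rewrite subr0 => h1 h2; rewrite -addrA; apply: (le_lt_trans (normcD _ _)); lra.
have -> : 4 * M / r * normc (z - w) = 2 * (M * normc (z - w)) / (r / 2) by field; rewrite gt_eqF.
have d1 u v : normc (u - 0) <= 3 / 2 * (r / 2) -> normc (v - c) < r ->
    cderiv (fun x => f (x + v)) u (df (u + v)).
  by move=> hu hv; apply: cderiv_shift; apply: hd; exact: dist.
apply: (@cauchy_estimate _ (fun u => f (u + z) - f (u + w)) 0).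
- by rewrite divr_gt0.
- have r00 : normc (0 - 0 : R[i]) <= 3 / 2 * (r / 2) by rewrite subrr normc0; lra.
  by have := cderivB (d1 0 z r00 hz) (d1 0 w r00 hw); rewrite !add0r.
- by move=> u hu; exists (df (u + z) - df (u + w)); apply: cderivB; exact: d1.
- move=> u /andP[_ hu]; have -> : z - w = u + z - (u + w) by ring.
  by apply: (cderiv_mvt_disc hd hM); exact: dist.
Qed.

Lemma deriv_locally_bounded f df c r : 0 < r ->
  (forall z, normc (z - c) < r -> cderiv f z (df z)) ->
  exists2 s, 0 < s <= r & exists M, forall z, normc (z - c) < s -> normc (df z) <= M.
Proof.
move=> r0 hd.
have [t t0 ht] := cderiv_cont (hd c ltac:(by rewrite subrr normc0)) ltr01.
pose s := Num.min r t; have s0 : 0 < s by rewrite lt_min r0.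
have sr : s <= r by rewrite ge_min lexx.
have st : s <= t by rewrite ge_min lexx orbT.
exists (s / 2); first by apply/andP; split; lra.
exists (2 * (normc (f c) + 1) / (s / 4)) => z hz.
have near x : normc (x - z) <= 3 / 2 * (s / 4) -> normc (x - c) < s.
  by move=> hx; have := normc_tri z x c; lra.
apply: (@cauchy_estimate _ f z); first by lra.
- by apply: hd; lra.
- by move=> x /near hx; exists (df x); apply: hd; exact: lt_le_trans hx sr.
- move=> x /andP[_ /near hx]; have := ht (x - c) (lt_le_trans hx st).
  by rewrite (addrC c) subrK; have := normcD (f x - f c) (f c); rewrite subrK; lra.
Qed.

(** Difference quotients of [f] with steps [h] and [k] differ by [O(|h| + |k|)] on a disc. Cauchy's
    estimate carries this over to their derivatives [Dq h] and [Dq k] at [c], and completeness gives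
    the limit. *)
Lemma deriv_cdiff f df c r : 0 < r ->
  (forall z, normc (z - c) < r -> cderiv f z (df z)) -> cdiff df c.
Proof.
move=> r0 hd.
have [s /andP[s0 sr] [M hM]] := deriv_locally_bounded r0 hd.
have [s4 hs4] : exists s4, s = 4 * s4 by exists (s / 4); field.
have s40 : 0 < s4 by lra.
have M0 : 0 <= M by apply: le_trans (hM c _); rewrite ?normc_ge0// subrr normc0.
pose L := 4 * M / (2 * s4).
have L0 : 0 <= L by rewrite divr_ge0 ?mulr_ge0 ?(ltW s40).
have lip z w : normc (z - c) < 2 * s4 -> normc (w - c) < 2 * s4 ->
    normc (df z - df w) <= L * normc (z - w).
  by apply: (deriv_lipschitz (f := f)) => [|x hx|x hx]; [lra|apply: hd; lra|apply: hM; lra].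
have quad u h : normc (u - c) < s4 -> normc h < s4 ->
    normc (f (u + h) - f u - df u * h) <= L * normc h * normc h.
  move=> hu hh.
  have e1 t : u + (t%:C)%C * (u + h - u) = u + (t%:C)%C * h by ring.
  have tn t : 0 <= t <= 1 -> normc ((t%:C)%C * h) <= normc h.
    by move=> /andP[t0 t1]; rewrite normcM normcR ger0_norm// ler_piMl ?normc_ge0.
  have inn x : normc x <= normc h -> normc (u + x - c) < 2 * s4.
    by move=> hx; have := normcD (u - c) x; rewrite addrAC; lra.
  have := @cderiv_mvt _ (fun x => f x - df u * x) (fun x => df x - df u) u (u + h) (L * normc h).
  have -> : f (u + h) - df u * (u + h) - (f u - df u * u) = f (u + h) - f u - df u * h by ring.
  rewrite (addrC u h) addrK (addrC h u); apply => t ht; have := tn _ ht => th.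
  - apply: cderivB; first by apply: hd; have := inn _ th; lra.
    by rewrite -[X in cderiv _ _ X]mulr1; apply: cderivZ; exact: cderiv_id.
  - apply: (le_trans (lip _ _ (inn _ th) _)); first by lra.
    by rewrite (addrC u) addrK ler_wpM2l.
pose Dq h := (df (c + h) - df c) / h.
pose K := 4 * L / s4.
have K0 : 0 <= K by apply: divr_ge0; [apply: mulr_ge0 | exact: ltW].
have Dqdist h k : h != 0 -> k != 0 -> normc h < s4 -> normc k < s4 ->
    normc (Dq h - Dq k) <= K * (normc h + normc k).
  move=> h0 k0 hh hk.
  have -> : K * (normc h + normc k) = 2 * (L * (normc h + normc k)) / (s4 / 2).
    by rewrite /K; field; rewrite gt_eqF.
  have inn x y : normc (x - c) <= 3 / 2 * (s4 / 2) -> normc y < s4 -> normc (x + y - c) < s.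
    by move=> hx hy; have := normcD (x - c) y; rewrite addrAC; lra.
  have dq x y : normc (x - c) <= 3 / 2 * (s4 / 2) -> normc y < s4 ->
      cderiv (fun x => y^-1 * (f (x + y) - f x)) x (y^-1 * (df (x + y) - df x)).
    move=> hx hy; apply: cderivZ; apply: cderivB; last by apply: hd; lra.
    by apply: cderiv_shift; apply: hd; have := inn _ _ hx hy; lra.
  apply: (@cauchy_estimate _ (fun x => h^-1 * (f (x + h) - f x) - k^-1 * (f (x + k) - f x)) c).
  - by lra.
  - by rewrite /Dq mulrC (mulrC _ k^-1); apply: cderivB; apply: dq => //; rewrite subrr normc0; lra.
  - by move=> x hx; eexists; apply: cderivB; apply: dq.
  - move=> x /andP[_ hx].
    have one y : y != 0 -> normc y < s4 -> normc (y^-1 * (f (x + y) - f x) - df x) <= L * normc y.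
      move=> y0 hy; have ny : 0 < normc y by rewrite normc_gt0.
      rewrite -(ler_pM2r ny) -normcM.
      have -> : (y^-1 * (f (x + y) - f x) - df x) * y = f (x + y) - f x - df x * y by field.
      by apply: quad => //; lra.
    have := one _ h0 hh; have := one _ k0 hk.
    set A := h^-1 * _; set B := k^-1 * _ => hB hA.
    have := normcB (A - df x) (B - df x).
    have -> : A - df x - (B - df x) = A - B by ring.
    rewrite mulrDr; lra.
pose sq (n : nat) : R := s4 / 2 / 2 ^+ n.
have sq0 n : 0 < sq n by rewrite !divr_gt0// exprn_gt0.
have sqS n : sq n.+1 = sq n / 2 by rewrite /sq exprS; field; rewrite expf_neq0.
have sqs n : sq n <= s4 / 2.
  elim: n => [|n IH]; first by rewrite /sq expr0 divr1.
  by rewrite sqS; have := sq0 n; lra.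
have nsq n : normc ((sq n)%:C)%C = sq n by rewrite normcR gtr0_norm.
have sqn0 n : ((sq n)%:C)%C != 0 :> R[i] by rewrite -normc_gt0 nsq.
(* Along the halved steps [sq n] the process never stops, hence the trivial [bad]; only convergence
   is wanted. *)
have [||d hd2] := @nested_limit R nat (fun n => Dq ((sq n)%:C)%C) (fun n => 2 * (K + 1) * sq n)
    (fun=> True) _ _ 0%N I.
- by move=> n _; rewrite mulr_ge0 ?mulr_ge0 ?(ltW (sq0 n))//; lra.
- move=> n _; exists n.+1; split => //; first by rewrite sqS mulrA.
  apply: (le_trans (Dqdist _ _ (sqn0 _) (sqn0 _) _ _)); rewrite ?nsq.
  + by have := sqs n.+1; lra.
  + by have := sqs n; lra.
  + rewrite sqS; have := sq0 n => q0; have : 0 <= K * sq n by rewrite mulr_ge0// ltW.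
    lra.
have Dqlim h : h != 0 -> normc h < s4 -> normc (Dq h - d) <= K * normc h.
  move=> h0 hh; rewrite leNgt; apply/negP => hlt.
  have [n [_ h1 h2]] := hd2 ((normc (Dq h - d) - K * normc h) / 4) ltac:(lra).
  have := Dqdist _ _ h0 (sqn0 n) hh; rewrite nsq => /(_ _).
  have := sqs n => sn /(_ ltac:(lra)) h3.
  have := normc_tri (Dq ((sq n)%:C)%C) (Dq h) d; have := normc_distC (Dq ((sq n)%:C)%C) d.
  have : 0 < sq n := sq0 n; have : 0 <= K * sq n by rewrite mulr_ge0// ltW.
  lra.
exists d => e e0.
exists (Num.min s4 (e / (K + 1))); first by rewrite lt_min s40 divr_gt0//; lra.
move=> h; rewrite lt_min => /andP[h1 h2].
have [->|h0] := eqVneq h 0.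
  by rewrite addr0 subrr mulr0 subr0 normc0 mulr0.
have -> : df (c + h) - df c - d * h = (Dq h - d) * h by rewrite /Dq; field.
rewrite normcM ler_wpM2r ?normc_ge0//.
apply: (le_trans (Dqlim _ h0 h1)); move: h2; rewrite ltr_pdivlMr; last by lra.
have := normc_ge0 h; rewrite mulrDr mulr1 mulrC; lra.
Qed.

Lemma taylor2 f df c r : 0 < r ->
  (forall z, normc (z - c) < r -> cderiv f z (df z)) ->
  exists b, forall e, 0 < e -> exists2 s, 0 < s & forall h, normc h < s ->
    normc (f (c + h) - f c - df c * h - b * (h * h)) <= e * (normc h * normc h).
Proof.
move=> r0 hd; have [d2 hd2] := deriv_cdiff r0 hd.
exists (d2 / 2) => e e0; have [s s0 hs] := hd2 _ e0.
exists (Num.min r s); first by rewrite lt_min r0.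
move=> h; rewrite lt_min => /andP[hr hs'].
have := @cderiv_mvt _ (fun x => f x - df c * x - d2 / 2 * ((x - c) * (x - c)))
  (fun x => df x - df c - d2 * (x - c)) c (c + h) (e * normc h).
have -> : f (c + h) - df c * (c + h) - d2 / 2 * ((c + h - c) * (c + h - c)) -
  (f c - df c * c - d2 / 2 * ((c - c) * (c - c))) = f (c + h) - f c - df c * h - d2 / 2 * (h * h).
  by ring.
have -> : e * (normc h * normc h) = e * normc h * normc h by rewrite mulrA.
rewrite (addrC c h) addrK (addrC h c); apply => t /andP[t0 t1];
  have th : normc ((t%:C)%C * h) <= normc h by rewrite normcM normcR ger0_norm// ler_piMl ?normc_ge0.
- apply: cderivB; first apply: cderivB.
  + by apply: hd; rewrite (addrC c) addrK; exact: le_lt_trans th hr.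
  + by rewrite -[X in cderiv _ _ X]mulr1; apply: cderivZ; exact: cderiv_id.
  + set x := c + _; have -> : d2 * (x - c) = d2 / 2 * (1 * (x - c) + (x - c) * 1) by field.
    apply: cderivZ; apply: (cderivM (f := fun x => x - c) (g := fun x => x - c));
      by rewrite -[X in cderiv _ _ X]subr0; apply: cderivB; [exact: cderiv_id|exact: cderiv_cst].
- rewrite (addrAC c _ (- c)) subrr add0r; apply: (le_trans (hs _ (le_lt_trans th hs'))).
  by rewrite ler_pM2l.
Qed.

(* Riemann's trick: [(z - c)^2 f] is differentiable at [c] with zero derivative,
   so two second-order expansions recover [f]. *)
Lemma removable_singularity f c r : 0 < r ->
  (forall z, z != c -> normc (z - c) < r -> cdiff f z) ->
  (forall e, 0 < e -> exists2 s, 0 < s &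
     forall z, z != c -> normc (z - c) < s -> normc (z - c) * normc (f z) <= e) ->
  exists y, cdiff (fun z => if z == c then y else f z) c.
Proof.
move=> r0 hdf hsmall.
have sub z : cdiff (fun x => x - c) z.
  by apply: cdiffB; [exact: cdiff_id|exact: cdiff_cst].
have ch u : u != 0 -> c + u != c by move=> u0; rewrite -subr_eq0 addrAC subrr add0r.
have cu u : c + u - c = u by rewrite addrAC subrr add0r.
pose h z := (z - c) * ((z - c) * f z).
have h0 : cderiv h c 0.
  move=> e e0; have [s s0 hs] := hsmall e e0; exists s => // u us.
  rewrite /h subrr !mul0r !subr0 cu.
  have [->|u0] := eqVneq u 0; first by rewrite mul0r normc0 mulr0.
  rewrite normcM mulrC ler_wpM2r ?normc_ge0//.
  by have := hs (c + u) (ch _ u0); rewrite cu normcM; exact.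
have hh z : normc (z - c) < r -> cdiff h z.
  have [-> _|zc hz] := eqVneq z c; first by exists 0.
  by apply: cdiffM => //; apply: cdiffM => //; exact: hdf.
have [dh hdh] := cdiff_choice hh.
have [b hb] := taylor2 r0 hdh.
have dhc : dh c = 0 by apply: cderiv_unique h0; apply: hdh; rewrite subrr normc0.
have hlim e : 0 < e -> exists2 s, 0 < s & forall u, u != 0 -> normc u < s -> normc (f (c + u) - b) <= e.
  move=> e0; have [s s0 hs] := hb e e0; exists s => // u u0 /hs.
  rewrite dhc /h cu subrr !mul0r !subr0.
  have -> : u * (u * f (c + u)) - b * (u * u) = (f (c + u) - b) * (u * u) by ring.
  by rewrite !normcM ler_pM2r// mulr_gt0// normc_gt0.
(* Now [f] is known to tend to [b], so [k] has derivative [b] at [c]. Its second-order expansion,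
   divided by [u], is the first-order expansion of the extended [f]. *)
pose k z := (z - c) * f z.
have k0 : cderiv k c b.
  move=> e e0; have [s s0 hs] := hlim e e0; exists s => // u us.
  rewrite /k subrr mul0r subr0 cu.
  have [->|u0] := eqVneq u 0; first by rewrite mul0r mulr0 subr0 normc0 mulr0.
  have -> : u * f (c + u) - b * u = (f (c + u) - b) * u by ring.
  by rewrite normcM ler_wpM2r ?normc_ge0// hs.
have hk z : normc (z - c) < r -> cdiff k z.
  have [-> _|zc hz] := eqVneq z c; first by exists b.
  by apply: cdiffM => //; exact: hdf.
have [dk hdk] := cdiff_choice hk.
have [b2 hb2] := taylor2 r0 hdk.
have dkc : dk c = b by apply: cderiv_unique k0; apply: hdk; rewrite subrr normc0.
exists b, b2 => e e0; have [s s0 hs] := hb2 e e0; exists s => // u /hs.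
rewrite eqxx dkc /k cu subrr mul0r subr0.
have [->|u0] := eqVneq u 0; first by move=> _; rewrite addr0 eqxx /= subrr mulr0 subr0 normc0 mulr0.
rewrite (negbTE (ch _ u0)).
have -> : u * f (c + u) - b * u - b2 * (u * u) = (f (c + u) - b - b2 * u) * u by ring.
by rewrite normcM mulrA ler_pM2r// normc_gt0.
Qed.

End HolomorphicDerivative.

(** * Bloch's theorem *)

Section Bloch.
Variable R : realType.
Implicit Types (f df : R[i] -> R[i]) (a u w z : R[i]) (M r : R).

(* Newton's iteration with the fixed slope [df a]. *)
Lemma landau_covering f df a r w : 0 < r ->
  (forall z, normc (z - a) < r -> cderiv f z (df z)) ->
  (forall z, normc (z - a) < r -> normc (df z) <= 2 * normc (df a)) ->
  64 * normc (f a - w) < r * normc (df a) ->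
  exists2 z, normc (z - a) < r & f z = w.
Proof.
move=> r0 hd hM hw.
set m := normc (df a) in hM hw.
have m0 : 0 < m.
  by rewrite -(pmulr_rgt0 _ r0); apply: le_lt_trans hw; rewrite mulr_ge0 ?normc_ge0.
have da0 : df a != 0 by rewrite -normc_gt0.
(* With radius [r / 2] and bound [2 * m], [deriv_lipschitz] has constant [16 * m / r]; on the disc
   of radius [p] the slope thus deviates from [df a] by at most [m / 2]. *)
pose p := r / 32.
have p0 : 0 < p by rewrite divr_gt0.
have pr : p < r by rewrite /p; lra.
have aa q : 0 < q -> normc (a - a) < q by rewrite subrr normc0.
have lip u u' : normc (u - a) < p -> normc (u' - a) < p ->
    normc (f u' - df a * u' - (f u - df a * u)) <= m / 2 * normc (u' - u).
  apply: (@cderiv_mvt_disc _ (fun x => f x - df a * x) (fun x => df x - df a) a p).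
    move=> z hz; apply: cderivB; first by apply: hd; lra.
    by rewrite -[X in cderiv _ _ X]mulr1; apply: cderivZ; exact: cderiv_id.
  move=> z hz; have r20 : 0 < r / 2 by lra.
  have := @deriv_lipschitz _ f df a (r / 2) (2 * m) z a r20.
  have -> : 2 * (r / 2) = r by field.
  have hz2 : normc (z - a) < r / 2 by apply: lt_trans hz _; rewrite /p; lra.
  move=> /(_ hd hM hz2 (aa _ r20)) h; apply: (le_trans h).
  have -> : 4 * (2 * m) / (r / 2) = m / 2 / p by rewrite /p; field; rewrite gt_eqF.
  by rewrite mulrAC ler_pdivrMr// ler_wpM2l ?ltW// divr_gt0.
(* Steps halve, so twice the present step bounds all future displacement and the iteration stays in
   the disc. At [a] this reads [2 * normc (f a - w) / m < r / 32], the source of 64. *)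
pose bad u := normc (u - a) + 2 * (normc (f u - w) / m) < p.
have bad0 : bad a.
  rewrite /bad subrr normc0 add0r mulrA ltr_pdivrMr// /p; lra.
have [|||z hz] := @nested_limit R _ id (fun u => normc (f u - w) / m) bad _ _ a.
- by move=> u _; rewrite divr_ge0 ?normc_ge0// ltW.
- move=> u hu; have s0 : 0 <= normc (f u - w) / m by rewrite divr_ge0 ?normc_ge0// ltW.
  pose u' := u - (f u - w) / df a.
  have du : normc (u' - u) = normc (f u - w) / m.
    have -> : u' - u = - ((f u - w) / df a) by rewrite /u'; ring.
    by rewrite normcN normcM normcV.
  have hu1 : normc (u - a) < p by rewrite /bad in hu; lra.
  have hu2 : normc (u' - a) < p.
    by have := normc_tri u u' a; rewrite du; move: hu; rewrite /bad; lra.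
  have half : normc (f u' - w) / m <= normc (f u - w) / m / 2.
    have := lip _ _ hu1 hu2; rewrite du.
    have -> : f u' - df a * u' - (f u - df a * u) = f u' - w by rewrite /u'; field.
    have -> : m / 2 * (normc (f u - w) / m) = normc (f u - w) / 2 by field; rewrite gt_eqF.
    by move=> h; rewrite mulrAC ler_pM2r// invr_gt0.
  exists u'; split => //=; last by rewrite du.
  rewrite /bad; have := normcD (u' - u) (u - a); rewrite addrA subrK du.
  move: hu; rewrite /bad; lra.
- exact: bad0.
have zr : normc (z - a) < r.
  have [u [hb hs hu]] := hz 1 ltr01.
  have := normcD (z - u) (u - a); rewrite addrA subrK.
  move: hb hu; rewrite /bad /=; lra.
exists z => //; apply/subr0_eq/normc_arbitrarily_small => e e0.
have [t t0 ht] := cderiv_cont (hd z zr) (e := e / 2) ltac:(lra).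
have [u [_ hs hu]] := hz (Num.min (t / 2) (e / 2 / m)) ltac:(by rewrite lt_min !divr_gt0).
move: hs; rewrite lt_min => /andP[h1 h2].
rewrite ltr_pM2r ?invr_gt0// in h2.
have := ht (u - z); rewrite (addrC z) subrK normc_distC => /(_ ltac:(rewrite /= in hu; lra)) h3.
have := normcB (f u - w) (f u - f z).
have -> : f u - w - (f u - f z) = f z - w by ring.
lra.
Qed.

(* If the derivative is too large, the covering lemma forces a nearby point where
   it has doubled; iterating contradicts local boundedness. *)
Lemma bloch_omitted_net f df a r : 0 < r ->
  (forall z, normc (z - a) < r -> cderiv f z (df z)) ->
  (forall w, exists2 e, normc (w - e) <= 1 & forall z, normc (z - a) < r -> f z <> e) ->
  normc (df a) <= 200 / r.
Proof.
move=> r0 hd hnet; rewrite leNgt; apply/negP => hlt.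
(* The covering lemma needs more than 64 times the net radius 1, and 100 suffices. The search radii
   halve when the derivative doubles, so they total at most twice the first. *)
pose bad z := 0 < normc (df z) /\ normc (z - a) + 2 * (100 / normc (df z)) < r.
have bad0 : bad a.
  split; first by apply: lt_trans hlt; rewrite divr_gt0.
  rewrite subrr normc0 add0r; move: hlt; rewrite ltr_pdivrMr// => h.
  rewrite mulrA ltr_pdivrMr; first by lra.
  by rewrite -(pmulr_lgt0 _ r0); apply: lt_trans h.
have [|||z hz] := @nested_limit R _ id (fun z => 100 / normc (df z)) bad _ _ a.
- by move=> z [z0 _]; rewrite divr_ge0// ltW.
- move=> z [z0 hz].
  have s0 : 0 < 100 / normc (df z) by rewrite divr_gt0.
  have [hall|/existsNP[z' /not_implyP[hz' /negP]]] := pselect (forall z',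
      normc (z' - z) < 100 / normc (df z) -> normc (df z') <= 2 * normc (df z)).
    exfalso; have [e he hom] := hnet (f z).
    have inn x : normc (x - z) < 100 / normc (df z) -> normc (x - a) < r.
      by move=> hx; have := normc_tri z x a; lra.
    have [|x /inn hx] := @landau_covering f df z _ e s0 (fun x hx => hd _ (inn x hx)) hall.
      by rewrite divfK ?gt_eqF//; lra.
    exact: hom.
  rewrite -ltNge => hgt; have z'0 : 0 < normc (df z') by lra.
  have half : 100 / normc (df z') <= 100 / normc (df z) / 2.
    rewrite ler_pdivrMr// mulrAC ler_pdivlMr// mulrAC ler_pdivlMr//; lra.
  exists z'; split => //; last exact: ltW.
  split => //; have := normc_tri z z' a; lra.
- exact: bad0.
have zr : normc (z - a) < r.
  have [u [[u0 hu1] hs hu2]] := hz 1 ltr01.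
  have := normc_tri u z a; rewrite /= in hu2; lra.
(* The derivative is bounded near the limit point, yet the points approaching it have
   [100 / normc (df u)] tending to 0. *)
have [|s /andP[s0 _] [M hM]] := @deriv_locally_bounded _ f df z (r - normc (z - a)) ltac:(lra).
  by move=> x hx; apply: hd; have := normc_tri z x a; lra.
have M1 : 0 < `|M| + 1 by rewrite ltr_wpDl.
have [u [[u0 _] hs hu]] := hz (Num.min (s / 2) (100 / (`|M| + 1))) ltac:(by rewrite lt_min !divr_gt0).
move: hs; rewrite lt_min => /andP[h1]; rewrite ltr_pM2l// ltf_pV2 ?posrE// => h2.
have := hM u ltac:(rewrite normc_distC; rewrite /= in hu; lra).
have := ler_norm M; lra.
Qed.

End Bloch.

(** * Functions omitting a net *)

Section Rigidity.
Variable R : realType.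
Implicit Types (f g df : R[i] -> R[i]) (a e u w z : R[i]) (s r : R).

(** The Lipschitz constant [4 * B / r] of the derivative tends to 0 as [r] grows, so the derivative
    is constant. *)
Lemma liouville_affine f df (B : R) : (forall z, cderiv f z (df z)) ->
  (forall z, normc (df z) <= B) -> forall z, f z = df 0 * z + f 0.
Proof.
move=> hd hB.
have cst z : df z = df 0.
  apply/subr0_eq/normc_arbitrarily_small => e e0; have B0 : 0 <= B by apply: le_trans (hB 0); exact: normc_ge0.
  have n0 := normc_ge0 z.
  have B1 : 0 <= 4 * B * normc z / e by rewrite divr_ge0 ?mulr_ge0// ltW.
  pose r := normc z + 1 + 4 * B * normc z / e.
  have r0 : 0 < r by rewrite /r; lra.
  have := @deriv_lipschitz _ f df 0 r B z 0 r0 (fun x _ => hd x) (fun x _ => hB x).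
  rewrite !subr0 normc0 => /(_ ltac:(rewrite /r; lra) r0) h; apply: (le_trans h).
  rewrite mulrAC ler_pdivrMr// -ler_pdivrMl// mulrC /r; lra.
move=> z; apply/subr0_eq/eq0_normc/le_anti/andP; split; last exact: normc_ge0.
have := @cderiv_mvt _ (fun x => f x - df 0 * x) (fun x => df x - df 0) 0 z 0.
have -> : f z - df 0 * z - (f 0 - df 0 * 0) = f z - (df 0 * z + f 0) by ring.
rewrite mul0r; apply => t _; last by rewrite cst subrr normc0.
apply: cderivB => //; rewrite -[X in cderiv _ _ X]mulr1; apply: cderivZ; exact: cderiv_id.
Qed.

(** The cross term is nonnegative, so the squared modulus is at least [(1 - t) ^+ 2 + t ^+ 2], which
    is at least [1 / 2], times that of [u]. *)
Lemma segment_far_from_0 u (eta t : R) : u != 0 -> normc u <= `|eta| -> 0 <= complex.Re u * eta ->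
  0 <= t <= 1 ->
  normc u / 2 <= normc ((eta%:C)%C + (t%:C)%C * (u - (eta%:C)%C)) <= `|eta|.
Proof.
move=> u0 ue ure /andP[t0 t1]; have n0 := normc_ge0 u.
have -> : (eta%:C)%C + (t%:C)%C * (u - (eta%:C)%C) = ((1 - t)%:C)%C * (eta%:C)%C + (t%:C)%C * u.
  by rewrite rmorphB rmorph1 /=; ring.
apply/andP; split; last first.
  apply: (le_trans (normcD _ _)); rewrite !normcM !normcR (ger0_norm (x := 1 - t)) ?subr_ge0//.
  by rewrite (ger0_norm t0); have := ler_wpM2l t0 ue; lra.
rewrite -(ler_pXn2r (n := 2)) ?nnegrE ?divr_ge0 ?normc_ge0//.
have e2 : normc u ^+ 2 <= eta ^+ 2.
  by rewrite -[X in _ <= X]real_normK ?num_real// ler_pXn2r ?nnegrE.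
have -> : (normc u / 2) ^+ 2 = normc u ^+ 2 / 4 by field.
move: e2; rewrite normc_sqr [X in _ -> _ <= X]normc_sqr.
case: u u0 {ue n0} ure => a b _ /= ure; rewrite !(mul0r, subr0, mulr0, addr0, add0r) => e2.
set X := a ^+ 2 + b ^+ 2 in e2 *.
have X0 : 0 <= X by rewrite addr_ge0 ?sqr_ge0.
have -> : ((1 - t) * eta + t * a) ^+ 2 + (t * b) ^+ 2 =
  (1 - t) ^+ 2 * eta ^+ 2 + t ^+ 2 * X + 2 * (t * (1 - t)) * (a * eta) by rewrite /X; ring.
have p1 : (1 - t) ^+ 2 * X <= (1 - t) ^+ 2 * eta ^+ 2 by rewrite ler_wpM2l ?sqr_ge0.
have p2 : 0 <= 2 * (t * (1 - t)) * (a * eta) by rewrite mulr_ge0// mulr_ge0// mulr_ge0// subr_ge0.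
have p3 : 0 <= (2 * t - 1) ^+ 2 * X by rewrite mulr_ge0 ?sqr_ge0.
have : (1 - t) ^+ 2 * X + t ^+ 2 * X = X / 2 + (2 * t - 1) ^+ 2 * X / 2 by field.
lra.
Qed.

(* A derivative of size [O(1/|z-e|)] only allows logarithmic growth; comparing with
   the two points [e +- eta] avoids computing it. *)
Lemma small_growth f df e s (K : R) : 0 < s -> 0 < K ->
  (forall z, z != e -> normc (z - e) <= s -> cderiv f z (df z)) ->
  (forall z, z != e -> normc (z - e) <= s -> normc (df z) <= K / normc (z - e)) ->
  forall eps, 0 < eps -> exists2 r, 0 < r &
    forall z, z != e -> normc (z - e) < r -> normc (z - e) * normc (f z) <= eps.
Proof.
move=> s0 K0 hd hK eps eps0.
(* The segment has length at most [2 * eta] and derivative at most [2 * K / normc u]; multiplied by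
   [normc u] this gives [4 * K * eta], at most [eps / 2]. *)
pose eta := Num.min s (eps / (8 * K)).
have eta0 : 0 < eta by rewrite lt_min s0 divr_gt0// mulr_gt0.
have etas : eta <= s by rewrite ge_min lexx.
have etaK : eta * (8 * K) <= eps.
  by rewrite -ler_pdivlMr ?mulr_gt0// ge_min lexx orbT.
pose B := normc (f (e + (eta%:C)%C)) + normc (f (e - (eta%:C)%C)) + 1.
have B0 : 0 < B by rewrite ltr_wpDl ?addr_ge0 ?normc_ge0.
exists (Num.min eta (eps / (2 * B))); first by rewrite lt_min eta0 divr_gt0// mulr_gt0.
move=> z ze; rewrite lt_min => /andP[h1 h2].
rewrite ltr_pdivlMr ?mulr_gt0// in h2.
have [u hu] : exists u, z = e + u by exists (z - e); rewrite addrC subrK.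
have zu : z - e = u by rewrite hu addrAC subrr add0r.
have u0 : u != 0 by rewrite -zu subr_eq0.
have nu : 0 < normc u by rewrite normc_gt0.
rewrite zu in h1 h2 *.
(* The sign puts [tau] in the same closed half-plane as [u], so the segment between them avoids the
   singularity. *)
have [tau [tE tre tB]] : exists tau : R, [/\ `|tau| = eta, 0 <= complex.Re u * tau
    & normc (f (e + (tau%:C)%C)) <= B].
  have fn0 x := normc_ge0 (f x).
  have [h|h] := lerP 0 (complex.Re u).
    exists eta; split; [by rewrite gtr0_norm|by rewrite mulr_ge0// ltW|].
    by rewrite /B; have := fn0 (e - (eta%:C)%C); lra.
  exists (- eta); split; [by rewrite normrN gtr0_norm|by rewrite mulrN -mulNr mulr_ge0 ?oppr_ge0 ?ltW|].
  by rewrite /B rmorphN; have := fn0 (e + (eta%:C)%C); lra.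
have seg t : 0 <= t <= 1 -> normc u / 2 <= normc ((tau%:C)%C + (t%:C)%C * (u - (tau%:C)%C)) <= eta.
  by rewrite -tE; apply: segment_far_from_0 => //; rewrite tE ltW.
have := @cderiv_mvt _ f df (e + (tau%:C)%C) (e + u) (K / (normc u / 2)).
have -> : e + u - (e + (tau%:C)%C) = u - (tau%:C)%C by ring.
have pt t : 0 <= t <= 1 -> let x := e + (tau%:C)%C + (t%:C)%C * (u - (tau%:C)%C) in
    [/\ x != e, normc (x - e) <= s & normc u / 2 <= normc (x - e)].
  move=> /seg /andP[s1 s2] x; have xe : x - e = (tau%:C)%C + (t%:C)%C * (u - (tau%:C)%C) by rewrite /x; ring.
  split; rewrite ?xe//; last exact: le_trans s2 etas.
  by rewrite -subr_eq0 xe -normc_gt0; apply: lt_le_trans s1; rewrite divr_gt0.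
move=> hmv; have {hmv} hf : normc (f (e + u) - f (e + (tau%:C)%C)) <= K / (normc u / 2) * normc (u - (tau%:C)%C).
  apply: hmv => t /pt[x1 x2 x3]; first exact: hd.
  apply: (le_trans (hK _ x1 x2)).
  by rewrite ler_pM2l// lef_pV2 ?posrE ?divr_gt0//; apply: lt_le_trans x3; rewrite divr_gt0.
rewrite hu.
have := normcD (f (e + u) - f (e + (tau%:C)%C)) (f (e + (tau%:C)%C)); rewrite subrK => hf2.
have ut : normc (u - (tau%:C)%C) <= 2 * eta.
  by have := normcB u (tau%:C)%C; rewrite normcR tE; lra.
have k1 : normc (f (e + u) - f (e + (tau%:C)%C)) * normc u <= 4 * K * eta.
  apply: (le_trans (ler_wpM2r (ltW nu) hf)).
  have -> : K / (normc u / 2) * normc (u - (tau%:C)%C) * normc u = 2 * K * normc (u - (tau%:C)%C).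
    by field; rewrite gt_eqF.
  have := ler_wpM2l (ltW K0) ut; lra.
have k2 : normc u * normc (f (e + u)) <= normc u *
    (normc (f (e + u) - f (e + (tau%:C)%C)) + normc (f (e + (tau%:C)%C))) by rewrite ler_wpM2l// ltW.
have k3 : normc u * normc (f (e + (tau%:C)%C)) <= normc u * B by rewrite ler_wpM2l// ltW.
rewrite mulrDr (mulrC (normc u) (normc (_ - _))) in k2.
lra.
Qed.

Lemma separated_ball (E : set R[i]) s z : 0 < s ->
  (forall e e', E e -> E e' -> e != e' -> 5 * s <= normc (e - e')) ->
  ~ E z -> exists2 r, 0 < r & forall x, normc (x - z) < r -> ~ E x.
Proof.
move=> s0 sep Ez; have [[e [Ee he]]|hn] := pselect (exists e, E e /\ normc (e - z) < 2 * s).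
  have ez : e != z by apply/eqP => ez; apply: Ez; rewrite -ez.
  exists (normc (e - z)); first by rewrite normc_gt0 subr_eq0.
  move=> x hx Ex; have [xe|xe] := eqVneq x e; first by rewrite xe ltxx in hx.
  have := sep _ _ Ex Ee xe; have := normc_tri z x e; rewrite (normc_distC z e); lra.
by exists (2 * s); [rewrite mulr_gt0 | move=> x hx Ex; apply: hn; exists x].
Qed.

(* A point within [s] of [E] is the centre of an annulus of radii [2 s] and [3 s]
   that stays at distance [s] from [E]: this needs the separation [5 s]. *)
Theorem affine_of_omitted (E E' : set R[i]) s f : 0 < s ->
  (forall e e', E e -> E e' -> e != e' -> 5 * s <= normc (e - e')) ->
  (forall w, exists2 e, E' e & normc (w - e) <= 1) ->
  (forall z, ~ E z -> cdiff f z) -> (forall z, ~ E z -> ~ E' (f z)) ->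
  exists a b, forall z, ~ E z -> f z = a * z + b.
Proof.
move=> s0 sep net hf hE'.
have bloch g dg z r : 0 < r -> (forall x, normc (x - z) < r -> cderiv g x (dg x)) ->
    (forall x, normc (x - z) < r -> ~ E x /\ g x = f x) -> normc (dg z) <= 200 / r.
  move=> r0 hd hx; apply: (bloch_omitted_net r0 hd) => w.
  have [e Ee we] := net w; exists e => // x /hx[Ex ->] fe; apply: (hE' x Ex); by rewrite fe.
have [df hdf] := cdiff_choice hf.
have punct e z : E e -> z != e -> normc (z - e) < 5 * s -> ~ E z.
  by move=> Ee ze hz Ez; have := sep _ _ Ez Ee ze; rewrite leNgt hz.
have rem e : exists y, E e -> cdiff (fun z => if z == e then y else f z) e.
  have [Ee|nE] := pselect (E e); last by exists 0.
  have [|z ze hz|eps eps0|y hy] := @removable_singularity _ f e (5 * s); last by exists y.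
  - by rewrite mulr_gt0.
  - by apply: hf; exact: punct hz.
  have s20 : 0 < 2 * s by rewrite mulr_gt0.
  apply: (@small_growth f df e (2 * s) 200) => // z ze hz.
    by apply: hdf; apply: punct ze _ => //; lra.
  (* As [z] is within [2 * s] of [e] and the rest of [E] is [5 * s] away from [e], the nearest point
     of [E] is [e] itself. *)
  have off x : normc (x - z) < normc (z - e) -> ~ E x.
    move=> hx Ex; have [xe|xe] := eqVneq x e; first by rewrite xe normc_distC ltxx in hx.
    have := sep _ _ Ex Ee xe; have := normc_tri z x e; lra.
  by apply: (@bloch f df) => [|x /off Ex|x /off Ex]; [rewrite normc_gt0 subr_eq0|exact: hdf|split].
have [y hy] := @choice _ _ (fun e y => E e -> cdiff (fun z => if z == e then y else f z) e) rem.
pose F z := if pselect (E z) then y z else f z.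
have FE z : ~ E z -> F z = f z by rewrite /F; case: pselect.
have hF z : cdiff F z.
  have [Ez|nE] := pselect (E z).
    have [d hd] := hy z Ez; exists d; apply: cderiv_near hd.
    exists (5 * s); first by rewrite mulr_gt0.
    move=> h hh; have [->|h0] := eqVneq h 0; first by rewrite addr0 eqxx /F; case: pselect.
    have zh : z + h != z by rewrite -subr_eq0 addrAC subrr add0r.
    by rewrite (negbTE zh) FE//; apply: punct zh _ => //; rewrite addrAC subrr add0r.
  have [d hd] := hf z nE; exists d; apply: cderiv_near hd.
  have [r r0 hr] := separated_ball s0 sep nE; exists r => // h hh.
  by apply: FE; apply: hr; rewrite addrAC subrr add0r.
have [dF hdF] := @cdiff_choice _ F (fun=> True) (fun z _ => hF z).
have far z : (forall x, normc (x - z) < s -> ~ E x) -> normc (dF z) <= 200 / s.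
  move=> hz; apply: (@bloch F dF) => // x; first by move=> _; exact: hdF.
  by move=> /hz Ex; split => //; exact: FE.
have bnd z : normc (dF z) <= 600 / s.
  have [hz|/existsNP[e /not_implyP[ez /contrapT Ee]]] :=
    pselect (forall x, normc (x - z) < s -> ~ E x).
    by apply: (le_trans (far _ hz)); rewrite ler_pM2r ?invr_gt0//; lra.
  have [ddF hddF] : exists ddF, forall x, True -> cderiv dF x (ddF x).
    by apply: cdiff_choice => x _; apply: (deriv_cdiff (f := F) ltr01) => ? _; exact: hdF.
  (* The factor [x - z] makes [dF z] itself the derivative at [z], so Cauchy's estimate acts as a
     maximum principle: on the annulus the product is at most [3 * s * (200 / s)]. *)
  have dG x : cderiv (fun x => (x - z) * dF x) x (1 * dF x + (x - z) * ddF x).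
    apply: (cderivM (f := fun x => x - z)); last exact: hddF.
    by rewrite -[X in cderiv _ _ X]subr0; apply: cderivB; [exact: cderiv_id|exact: cderiv_cst].
  have -> : 600 / s = 2 * 600 / (2 * s) by field; rewrite gt_eqF.
  have -> : dF z = 1 * dF z + (z - z) * ddF z by rewrite subrr mul0r addr0 mul1r.
  apply: (@cauchy_estimate _ (fun x => (x - z) * dF x) z) => //.
  - by rewrite mulr_gt0.
  - by move=> x _; eexists; exact: dG.
  - move=> x /andP[x1 x2]; rewrite normcM.
    have x3 : normc (x - z) <= 3 * s by lra.
    have -> : 600 = 3 * s * (200 / s) by field; rewrite gt_eqF.
    apply: ler_pM; rewrite ?normc_ge0//; apply: far => q qx Eq.
    have [qe|qe] := eqVneq q e.
      by rewrite qe in qx; have := normc_tri e x z; rewrite (normc_distC x e); lra.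
    have := sep _ _ Eq Ee qe; have := normc_tri x q e; have := normc_tri z x e.
    rewrite (normc_distC z e); lra.
exists (dF 0), (F 0) => z Ez; rewrite -(FE z Ez).
by apply: (liouville_affine (B := 600 / s)) => // x; exact: hdF.
Qed.

End Rigidity.

(** * The Gaussian integers with an extra point *)

Section Lattice.
Variable R : realType.
Implicit Types (z w : R[i]) (th : R) (a b : int).

Definition gaussian : set R[i] := [set z | exists a b, z = Complex a%:~R b%:~R].

Definition marked_lattice th : set R[i] := [set z | gaussian z \/ z = (th%:C)%C].

(** Irrationality of [th], in the integral form produced by comparing coordinates. *)
Definition int_independent th := forall a b, a%:~R * th = b%:~R -> a = 0.

Lemma gaussian0 : gaussian 0.
Proof. by exists 0, 0. Qed.

Lemma gaussian1 : gaussian 1.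
Proof. by exists 1, 0. Qed.

Lemma gaussianD z w : gaussian z -> gaussian w -> gaussian (z + w).
Proof. by move=> [a [b ->]] [c [d ->]]; exists (a + c), (b + d); rewrite !intrD. Qed.

Lemma gaussianB z w : gaussian z -> gaussian w -> gaussian (z - w).
Proof. by move=> [a [b ->]] [c [d ->]]; exists (a - c), (b - d); rewrite !intrB. Qed.

Lemma not_gaussian th : int_independent th -> ~ gaussian (th%:C)%C.
Proof. by move=> hth [a [b [ha _]]]; have := hth 1 a; rewrite mul1r => /(_ ha). Qed.

Lemma nearest_int (x : R) : exists a, `|x - a%:~R| <= 1 / 2.
Proof.
exists (Num.floor (x + 1 / 2)); have := mem_rg1_floor (x + 1 / 2).
by rewrite /range1 /= => /andP[h1 h2]; rewrite ler_norml; apply/andP; split; lra.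
Qed.

Lemma gaussian_net w : exists2 e, gaussian e & normc (w - e) <= 1.
Proof.
have [a ha] := nearest_int (complex.Re w); have [b hb] := nearest_int (complex.Im w).
exists (Complex a%:~R b%:~R); first by exists a, b.
by apply: (le_trans (normc_ReIm _)); rewrite ReB ImB /=; lra.
Qed.

Lemma int_norm_ge1 a : a != 0 -> 1 <= `|a%:~R : R|.
Proof. by move=> a0; rewrite -intr_norm ler1z -gtz0_ge1 normr_gt0. Qed.

Lemma gaussian_separated z w : gaussian z -> gaussian w -> z != w -> 1 <= normc (z - w).
Proof.
move=> [a [b ->]] [c [d ->]]; rewrite eq_complex /= negb_and !eqr_int => /orP[h|h].
  apply: le_trans (normc_Re _); rewrite ReB /= -intrB.
  by apply: int_norm_ge1; rewrite subr_eq0.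
apply: le_trans (normc_Im _); rewrite ImB /= -intrB.
by apply: int_norm_ge1; rewrite subr_eq0.
Qed.

Lemma real_gaussian_separated th z : 1 / 4 <= th <= 3 / 4 -> gaussian z ->
  1 / 4 <= normc ((th%:C)%C - z).
Proof.
move=> /andP[h1 h2] [a [b ->]]; apply: le_trans (normc_Re _); rewrite ReB /=.
have [ha|ha] := lerP a 0.
  have : (a%:~R : R) <= 0 by rewrite lerz0.
  have := ler_norm (th - a%:~R); lra.
have : 1 <= (a%:~R : R) by rewrite ler1z -gtz0_ge1.
have := ler_norm (- (th - a%:~R)); rewrite normrN; lra.
Qed.

Lemma marked_lattice_separated th : 1 / 4 <= th <= 3 / 4 ->
  forall z w, marked_lattice th z -> marked_lattice th w -> z != w -> 5 * (1 / 20) <= normc (z - w).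
Proof.
move=> hth z w; have -> : 5 * (1 / 20) = 1 / 4 :> R by field.
move=> [gz|->] [gw|->] zw.
- by apply: le_trans (gaussian_separated gz gw zw); lra.
- by rewrite normc_distC; exact: real_gaussian_separated.
- exact: real_gaussian_separated.
- by rewrite eqxx in zw.
Qed.

(** The conclusion describes the inverse map, since that is the one carrying lattice points to
    lattice points: its coefficients are Gaussian, and the image of the extra point makes them
    real. *)
Lemma affine_marked_lattice (th1 th2 : R) (al be : R[i]) :
  int_independent th1 -> int_independent th2 -> al != 0 ->
  (forall z, ~ marked_lattice th1 z -> ~ marked_lattice th2 (al * z + be)) ->
  exists a b, [/\ al^-1 = Complex a%:~R 0, - be / al = Complex b%:~R 0
    & th1 = a%:~R * th2 + b%:~R].
Proof.
move=> i1 i2 al0 hmap; pose ga := al^-1; pose de := - be / al.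
have ga0 : ga != 0 by rewrite invr_eq0.
have hg w : marked_lattice th2 w -> marked_lattice th1 (ga * w + de).
  move=> hw; apply: contrapT => /hmap; apply.
  by have -> : al * (ga * w + de) + be = w by rewrite /ga /de; field.
(* At most one of [w], [w + 1], [w + 2] lands on the extra point. If [w] does, its image is
   extrapolated from the two Gaussian images and is therefore Gaussian. *)
have hG w : gaussian w -> gaussian (ga * w + de).
  move=> gw; have [//|e0] := hg w (or_introl gw).
  have g1 := gaussianD gw gaussian1; have g2 := gaussianD g1 gaussian1.
  have [q1|e1] := hg _ (or_introl g1); last first.
    case/eqP: ga0; have <- : (ga * (w + 1) + de) - (ga * w + de) = ga by ring.
    by rewrite e0 e1 subrr.
  have [q2|e2] := hg _ (or_introl g2); last first.
    case/eqP: ga0; have <- : ((ga * (w + 1 + 1) + de) - (ga * w + de)) / 2 = ga by field.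
    by rewrite e0 e2 subrr mul0r.
  have -> : ga * w + de = (ga * (w + 1) + de) - ((ga * (w + 1 + 1) + de) - (ga * (w + 1) + de)) by ring.
  exact: gaussianB q1 (gaussianB q2 q1).
have gde : gaussian de by have := hG _ gaussian0; rewrite mulr0 add0r.
have gga : gaussian ga.
  by have := gaussianB (hG _ gaussian1) gde; rewrite mulr1 addrK.
have [a [b gaE]] := gga; have [c [d deE]] := gde.
have gth : ga * (th2%:C)%C + de = Complex (a%:~R * th2 + c%:~R) (b%:~R * th2 + d%:~R).
  by rewrite gaE deE; apply/eqP; rewrite eq_complex /= !mulr0 subr0 add0r !eqxx.
(* A Gaussian image of [th2] would give [ga = 0] by irrationality, so [th2] goes to [th1]; the
   imaginary parts then vanish. *)
have := hg _ (or_intror erefl); rewrite gth => -[[x [y [ex ey]]]|[ex ey]].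
  have a0 : a = 0 by apply: (i2 a (x - c)); rewrite intrB -ex addrK.
  have b0 : b = 0 by apply: (i2 b (y - d)); rewrite intrB -ey addrK.
  by case/eqP: ga0; rewrite gaE a0 b0.
have b0 : b = 0 by apply: (i2 b (- d)); rewrite intrN -[RHS]add0r -ey addrK.
have d0 : d%:~R = 0 :> R by move: ey; rewrite b0 mul0r add0r.
by exists a, c; split => //; [rewrite -/ga gaE b0|rewrite -/de deE d0].
Qed.

Lemma self_map_marked_lattice th (f : R[i] -> R[i]) : int_independent th -> 1 / 4 <= th <= 3 / 4 ->
  (forall z, ~ marked_lattice th z -> cdiff f z) ->
  (forall z, ~ marked_lattice th z -> ~ marked_lattice th (f z)) ->
  (forall z, ~ marked_lattice th z -> f z = z) \/
  (exists c, forall z, ~ marked_lattice th z -> f z = c).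
Proof.
move=> ith hth hd hf.
have [|w|al [be hab]] := affine_of_omitted _ (marked_lattice_separated hth) _ hd hf; first by lra.
  by have [e ge we] := gaussian_net w; exists e => //; left.
have [al0|al0] := eqVneq al 0; [right|left].
  by exists be => z /hab ->; rewrite al0 mul0r add0r.
have [|a [b [e1 e2 e3]]] := affine_marked_lattice ith ith al0 (be := be).
  by move=> z hz; rewrite -hab//; exact: hf.
have a1 : a = 1.
  apply/subr0_eq; apply: (ith _ (- b)); rewrite intrB mulrBl mul1r intrN.
  by rewrite [in X in _ - X]e3 opprD addrA subrr add0r.
have b0 : b%:~R = 0 :> R by apply: (addrI th); rewrite addr0 [RHS]e3 a1 mul1r.
have al1 : al = 1 by rewrite -[al]invrK e1 a1 invr1.
have be0 : be = 0 by move: e2; rewrite al1 divr1 b0 => /eqP; rewrite oppr_eq0 => /eqP.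
by move=> z /hab ->; rewrite al1 be0 mul1r addr0.
Qed.

Lemma int_independent_double th : int_independent th -> int_independent (2 * th).
Proof.
move=> ith a b; rewrite mulrA => h; have := ith (a * 2) b.
by rewrite intrM => /(_ h)/eqP; rewrite mulf_eq0 orbF => /eqP.
Qed.

Lemma map_marked_lattice_double th (f : R[i] -> R[i]) : int_independent th ->
  1 / 4 <= th <= 3 / 8 ->
  (forall z, ~ marked_lattice th z -> cdiff f z) ->
  (forall z, ~ marked_lattice th z -> ~ marked_lattice (2 * th) (f z)) ->
  exists c, forall z, ~ marked_lattice th z -> f z = c.
Proof.
move=> ith hth hd hf.
have hth' : 1 / 4 <= th <= 3 / 4 by move/andP: hth => [? ?]; apply/andP; split; lra.
have i2 := int_independent_double ith.
have [|w|al [be hab]] := affine_of_omitted _ (marked_lattice_separated hth') _ hd hf; first by lra.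
  by have [e ge we] := gaussian_net w; exists e => //; left.
have [al0|al0] := eqVneq al 0.
  by exists be => z /hab ->; rewrite al0 mul0r add0r.
have [|a [b [_ _ e3]]] := affine_marked_lattice ith i2 al0 (be := be).
  by move=> z hz; rewrite -hab//; exact: hf.
have : 1 - a * 2 = 0.
  apply: (ith _ b); rewrite intrB intrM mulrBl mul1r [in X in X - _]e3; ring.
move=> /eqP; rewrite subr_eq0 => /eqP /(congr1 (fun x => odd `|x|%N)).
by rewrite abszM oddM andbF.
Qed.

(** The choice is a quarter of the square root of 2. A relation would give [a ^+ 2 = 8 * b ^+ 2],
    whose sides have 2-adic valuations of different parity. *)
Lemma exists_int_independent : exists2 th, int_independent th & 1 / 4 <= th <= 3 / 8.
Proof.
have s0 : 0 <= Num.sqrt 2 :> R by exact: sqrtr_ge0.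
have s2 : Num.sqrt 2 ^+ 2 = 2 :> R by rewrite sqr_sqrtr.
exists (Num.sqrt 2 / 4); last first.
  apply/andP; split; first by rewrite ler_pM2r// -[X in X <= _]sqrtr1 ler_sqrt//; lra.
  suff : Num.sqrt 2 <= 3 / 2 :> R by lra.
  by rewrite -(ler_pXn2r (n := 2)) ?nnegrE// s2; lra.
move=> a b hab; apply/eqP; apply: contraT => a0.
have h8 : a ^+ 2 = 8 * b ^+ 2.
  apply: (intr_inj (R := R)); rewrite !expr2 !intrM -hab.
  transitivity (a%:~R * a%:~R * Num.sqrt 2 ^+ 2 / 2 : R); last by field.
  by rewrite s2 mulfK.
have b0 : b != 0.
  by apply: contraNneq a0 => b0; move/eqP: h8; rewrite b0 expr0n mulr0 sqrf_eq0.
have := congr1 (fun x => logn 2 `|x|%N) h8.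
rewrite abszM !abszX lognM ?expn_gt0 ?absz_gt0 ?b0// !lognX => /(congr1 odd).
by rewrite oddD !oddM.
Qed.

End Lattice.

(** * Domains in C^n *)

(* The normed module structure of a [numFieldType] over itself is only found on
   types that are syntactically the sort of a [numFieldType]. *)
Definition cfield (R : realType) : numFieldType := R[i].

Section Bridge.
Variable R : realType.
Implicit Types (f : cfield R -> cfield R) (z w : cfield R).

Lemma complex_normE z : `|z| = ((normc z)%:C)%C.
Proof. by case: z. Qed.

Lemma gt0_complexE (e : R[i]) : 0 < e -> exists2 r : R, 0 < r & e = (r%:C)%C.
Proof. by case: e => a b; rewrite ltcE /= => /andP[/eqP -> a0]; exists a. Qed.

Lemma nbhs_normcP z (P : set (cfield R)) :
  nbhs z P <-> exists2 r : R, 0 < r & forall w, normc (w - z) < r -> P w.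
Proof.
split => [/(@nbhs_normP _ (cfield R)) [e /= /gt0_complexE[r r0 ->] h]|[r r0 h]].
  by exists r => // w hw; apply: h; rewrite /ball_ /= distrC complex_normE ltcR.
apply/(@nbhs_normP _ (cfield R)); exists (r%:C)%C; first by rewrite /= ltcR.
by move=> w; rewrite /ball_ /= distrC complex_normE ltcR; exact: h.
Qed.

(** The scalars are complex, so the directional derivative along 1 is already the limit over all
    complex increments. *)
Lemma cdiff_of_differentiable f z : differentiable f z -> cdiff f z.
Proof.
move=> hf; have /cvg_ex[/= d hd0] : derivable f z 1 by exact: diff_derivable.
have FF : Filter ((0 : cfield R)^') := dnbhs_filter (0 : cfield R).
have hd := (@cvgrPdist_le (cfield R) (cfield R) _ _ _ _ _).1 hd0.
exists d => e e0.
have /nbhs_normcP[r r0 hr] := hd FF (e%:C)%C ltac:(by rewrite ltcR).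
exists r => // h hh; have [->|h0] := eqVneq h 0.
  by rewrite addr0 subrr mulr0 subr0 normc0 mulr0.
have := hr h ltac:(by rewrite subr0) h0.
rewrite complex_normE lecR => hle.
have -> : f (z + h) - f z - d * h = - (d - h^-1 * (f (z + h) - f z)) * h by field.
rewrite normcM normcN; apply: ler_wpM2r; first exact: normc_ge0.
by apply: le_trans hle; rewrite /= /GRing.scale /= mulr1 (addrC h).
Qed.

Lemma continuous_real_complex : continuous (fun t : R => (t%:C)%C : cfield R).
Proof.
move=> t A /nbhs_normcP[r r0 hr]; apply/nbhs_ballP; exists r => //= s.
by rewrite -ball_normE /= distrC => hs; apply: hr; rewrite -rmorphB normcR.
Qed.

Lemma open_marked_lattice_compl (th : R) : 1 / 4 <= th <= 3 / 4 -> open (~` marked_lattice th : set (cfield R)).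
Proof.
move=> hth; rewrite openE => z /= Ez; apply/nbhs_normcP.
have [r r0 hr] := separated_ball (s := 1 / 20) ltac:(lra) (marked_lattice_separated hth) Ez.
by exists r.
Qed.

Lemma connected_component_path (T : topologicalType) (A : set T) (p : R -> T) :
  continuous p -> (forall t, 0 <= t <= 1 -> A (p t)) -> connected_component A (p 0) (p 1).
Proof.
move=> cp hp; exists (p @` `[0, 1]); last by exists 1 => //=; rewrite in_itv /= ler01 lexx.
split; first by exists 0 => //=; rewrite in_itv /= ler01 lexx.
  by move=> _ [t /= + <-]; rewrite in_itv /=; exact: hp.
apply: connected_continuous_connected; first exact: segment_connected.
exact: continuous_subspaceT.
Qed.

Lemma connected_component_segment (A : set (cfield R)) z w :
  (forall t : R, 0 <= t <= 1 -> A (z + (t%:C)%C * (w - z))) -> connected_component A z w.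
Proof.
move=> h; have := @connected_component_path _ A (fun t => z + (t%:C)%C * (w - z)) _ h.
rewrite rmorph0 mul0r addr0 rmorph1 mul1r (addrC z) subrK; apply.
move=> t; apply: cvgD; first exact: cvg_cst.
by apply: cvgM; [exact: continuous_real_complex|exact: cvg_cst].
Qed.

Lemma connected_marked_lattice_compl (th : R) : 1 / 4 <= th <= 3 / 4 ->
  connected (~` marked_lattice th : set (cfield R)).
Proof.
move=> /andP[th1 th2]; pose S : set (cfield R) := ~` marked_lattice th.
rewrite -[X in connected X]/S.
have int01 (x : R) (a : int) : 0 < x < 1 -> x <> a%:~R.
  move=> /andP[x0 x1] xa; move: x0 x1; rewrite xa ltr0z ltrz1 => a0 a1.
  by case: a {xa} a0 a1 => [[|m]|m].
have seg a b a' b' : (forall t : R, 0 <= t <= 1 -> S (Complex (a + t * (a' - a)) (b + t * (b' - b)))) ->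
    connected_component S (Complex a b) (Complex a' b').
  move=> h; apply: connected_component_segment => t /h.
  congr S; apply/eqP; rewrite eq_complex /=; apply/andP; split; apply/eqP; ring.
have noint (x : R) : (exists a : int, x = a%:~R) \/ ~ (exists a : int, x = a%:~R) by exact: EM.
have vert a b b' : ~ (exists k : int, a = k%:~R) -> a <> th ->
    connected_component S (Complex a b) (Complex a b').
  move=> ha ath; apply: seg => t _; rewrite subrr mulr0 addr0 => -[[k [l [ka _]]]|[ath' _]] //.
  by apply: ha; exists k.
have horiz a a' b : ~ (exists k : int, b = k%:~R) ->
    connected_component S (Complex a b) (Complex a' b).
  move=> hb; apply: seg => t _; rewrite subrr mulr0 addr0 => -[[k [l [_ kb]]]|[_ b0]].
    by apply: hb; exists l.
  by apply: hb; exists 0.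
have half : ~ (exists k : int, 1 / 2 = k%:~R :> R) by move=> [k]; apply: int01; lra.
have c78 : ~ (exists k : int, 7 / 8 = k%:~R :> R) by move=> [k]; apply: int01; lra.
have c78th : 7 / 8 <> th by move=> e; move: th2; rewrite -e; lra.
(* Both axis-parallel lines through [7 / 8 + i / 2] miss the lattice, since [th <= 3 / 4]; two
   axis-parallel segments reach any point from there. *)
have base z : S z -> connected_component S (Complex (7 / 8) (1 / 2)) z.
  case: z => a b Sz; apply: connected_component_sym.
  have [[k bk]|hb] := noint b; last first.
    by apply: connected_component_trans (horiz a (7 / 8) b hb) _; exact: vert.
  have [[l al]|ha] := noint a; first by case: Sz; left; exists l, k; rewrite al bk.
  have [ath|ath] := EM (a = th); last first.
    by apply: connected_component_trans (vert a b (1 / 2) ha ath) _; exact: horiz.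
  have b0 : b <> 0 by move=> b0; apply: Sz; right; rewrite ath b0.
  apply: (@connected_component_trans (cfield R) S (Complex (7 / 8) b)); last exact: vert.
  (* Here the abscissa is [th] and the ordinate a nonzero integer. Moving to [7 / 8] keeps the
     abscissa strictly between 0 and 1, off the Gaussian integers, and off the real axis. *)
  apply: seg => t /andP[t0 t1]; rewrite subrr mulr0 addr0 => -[[p [q [ap _]]]|[_ //]].
  by apply: int01 ap; rewrite ath; nra.
have Sb : S (Complex (7 / 8) (1 / 2)).
  by move=> [[k [l [e _]]]|[e _]]; [apply: c78; exists k|exact: c78th].
suff -> : S = connected_component S (Complex (7 / 8) (1 / 2)) by exact: component_connected.
by apply/seteqP; split; [exact: base|exact: connected_component_sub].
Qed.

End Bridge.

(** * The product of [n] punctured planes *)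

Section PolyDomain.
Variables (R : realType) (n : nat) (th : R).
Hypothesis hth : 1 / 4 <= th <= 3 / 4.
Implicit Types (x y z : 'rV[R[i]]_n) (k j : 'I_n) (t : cfield R).

Definition lattice_domain : set (Cn R n) :=
  [set z : 'rV[R[i]]_n | forall j, ~ marked_lattice th (z ord0 j)].

Definition row_set z k t : 'rV[R[i]]_n := \row_j (if j == k then t else z ord0 j).

Lemma row_set_diff z k j t : j != k -> row_set z k t ord0 j = z ord0 j.
Proof. by move=> jk; rewrite mxE (negbTE jk). Qed.

Lemma row_set_id z k : row_set z k (z ord0 k) = z.
Proof. by apply/rowP => j; rewrite mxE; case: eqP => [->|]. Qed.

Lemma row_set_comm z k j s t : j != k ->
  row_set (row_set z k s) j t = row_set (row_set z j t) k s.
Proof.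
move=> jk; apply/rowP => i; rewrite !mxE; case: (eqVneq i j) => [->|//].
by rewrite (negbTE jk).
Qed.

Lemma row_set_affine z k t :
  row_set z k t = z + (t - z ord0 k) *: delta_mx ord0 k.
Proof.
apply/rowP => j; rewrite !mxE eqxx /=; case: eqP => [->|_]; first by rewrite mulr1 addrC subrK.
by rewrite mulr0 addr0.
Qed.

Lemma row_set_domain z k t : lattice_domain z -> ~ marked_lattice th t ->
  lattice_domain (row_set z k t).
Proof. by move=> hz ht j; rewrite mxE; case: ifP. Qed.

(** Coordinates are exchanged one at a time; the hybrids [h m] stay in the domain because it is a
    product. This drives connectedness, constancy and the spreading of an identity. *)
Lemma row_set_ind (P : 'rV[R[i]]_n -> Prop) x y : lattice_domain x -> lattice_domain y -> P x ->
  (forall z k t, lattice_domain z -> ~ marked_lattice th t -> P z -> P (row_set z k t)) -> P y.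
Proof.
move=> hx hy Px step.
pose h (m : nat) : 'rV[R[i]]_n := \row_j (if (j < m)%N then y ord0 j else x ord0 j).
have hh m : lattice_domain (h m) by move=> j; rewrite mxE; case: ifP.
have -> : y = h n by apply/rowP => j; rewrite mxE ltn_ord.
have : (n <= n)%N by []; elim: {1 3}n => [_|m IH mn].
  by have -> : h 0%N = x by apply/rowP => j; rewrite mxE.
have -> : h m.+1 = row_set (h m) (Ordinal mn) (y ord0 (Ordinal mn)).
  apply/rowP => j; rewrite !mxE ltnS leq_eqVlt.
  case: (eqVneq j (Ordinal mn)) => [->|jm]; first by rewrite eqxx.
  by rewrite (_ : (nat_of_ord j == m) = false)//; apply/negbTE; apply: contraNneq jm => jm; apply/eqP/val_inj.
by apply: step => //; apply: IH; exact: ltnW.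
Qed.

Lemma row_set_differentiable z k t :
  differentiable (row_set z k : cfield R -> Cn R n) t.
Proof.
have -> : row_set z k = fun t => z + (t - z ord0 k) *: delta_mx ord0 k.
  by apply/funext => s; exact: row_set_affine.
apply: differentiableD; first exact: differentiable_cst.
apply: differentiableZl; apply: differentiableB; first exact: ex_diff.
exact: differentiable_cst.
Qed.

Lemma slice_cdiff (f : Cn R n -> Cn R n) z k j t :
  differentiable f (row_set z k t : Cn R n) -> cdiff (fun s => (f (row_set z k s) : 'rV[R[i]]_n) ord0 j) t.
Proof.
move=> hf; apply: cdiff_of_differentiable.
have h1 := differentiable_comp (row_set_differentiable z k t) hf.
exact: (differentiable_comp h1 (differentiable_coord (_ : 'M[cfield R]_(1, n)) ord0 j)).
Qed.

Lemma lattice_domain_open : open lattice_domain.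
Proof.
rewrite openE => z hz.
apply: (@filter_forall _ _ (fun j (y : 'rV[cfield R]_n) => ~ marked_lattice th (y ord0 j)) (nbhs z)) => j.
have hO : nbhs ((z : 'rV[cfield R]_n) ord0 j) (~` marked_lattice th).
  exact: open_nbhs_nbhs (conj (open_marked_lattice_compl hth) (hz j)).
exact: (@coord_continuous (cfield R) 1 n ord0 j z _ hO).
Qed.

(** The imaginary part [1 / 2] avoids every marked lattice whatever [a] is, which supplies distinct
    and arbitrarily large points. *)
Definition lattice_point (a : R) : 'rV[R[i]]_n := const_mx (Complex a (1 / 2)).

Lemma lattice_point_domain a : lattice_domain (lattice_point a).
Proof.
move=> j; rewrite mxE => -[[k [l [_ e]]]|[_ e]]; last by move: e; lra.
have [l0|l0] := lerP l 0.
  have : (l%:~R : R) <= 0 by rewrite lerz0.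
  by rewrite -e; lra.
have : 1 <= (l%:~R : R) by rewrite ler1z -gtz0_ge1.
by rewrite -e; lra.
Qed.

Lemma lattice_domain_connected : connected lattice_domain.
Proof.
set x0 := lattice_point 0; have hx0 : lattice_domain x0 by exact: lattice_point_domain.
suff -> : lattice_domain = connected_component lattice_domain x0 by exact: component_connected.
apply/seteqP; split; last exact: connected_component_sub.
move=> y hy; apply: (row_set_ind hx0 hy); first exact: connected_component_refl.
move=> z k t hz ht hc; apply: connected_component_trans hc _.
exists (row_set z k @` (~` marked_lattice th)); last by exists t.
split; first by exists (z ord0 k); [exact: hz|exact: row_set_id].
  by move=> _ [s hs <-]; exact: row_set_domain.
apply: (@connected_continuous_connected (cfield R) (Cn R n) _ (row_set z k)).
  exact: connected_marked_lattice_compl.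
apply: (@continuous_subspaceT (cfield R) (Cn R n)) => s.
exact: (differentiable_continuous (row_set_differentiable z k s)).
Qed.

Lemma lattice_domain_is_domain : is_domain lattice_domain.
Proof.
split; first exact: lattice_domain_open.
by split; [exact: lattice_domain_connected|exists (lattice_point 0); exact: lattice_point_domain].
Qed.

Lemma lattice_domain_unbounded : (0 < n)%N -> unbounded lattice_domain.
Proof.
move=> n0 [M [Mr hM]].
pose a := normc M + 1; have a0 : 0 <= a by rewrite addr_ge0 ?normc_ge0.
have Ma : M < (a%:C)%C.
  rewrite -(RRe_real Mr) ltcR; apply: (le_lt_trans (ler_norm _)).
  by apply: (le_lt_trans (normc_Re M)); rewrite /a ltrDl.
pose x := lattice_point (a + 1).
have xD : lattice_domain x by exact: lattice_point_domain.
have : mx_norm x <= (a%:C)%C := hM _ Ma x xD.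
have x0 : mx_norm x != 0.
  apply/eqP => /mx_norm_eq0 /rowP /(_ (Ordinal n0)); rewrite !mxE => -[e _].
  by move: e a0; lra.
have [i ->] := mx_norm_neq0 x0; rewrite mxE complex_normE lecR.
have := normc_Re (Complex (a + 1) (1 / 2)); rewrite /= ger0_norm; lra.
Qed.

End PolyDomain.

(** * Holomorphic maps between the domains *)

(** Elements of [E(D)] are total functions with arbitrary values off [D]; this lets a formula valid
    only on the open set decide differentiability. *)
Lemma near_eq_differentiable (K : numFieldType) (V W : normedModType K) (f g : V -> W) (x : V) :
  {near x, f =1 g} -> differentiable f x -> differentiable g x.
Proof.
move=> fg /diff_locallyP[dfc hf].
have gx : f x = g x by exact: nbhs_singleton fg.
have hg : g \o shift x = cst (g x) + 'd f x +o_ 0 id.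
  move/eqaddoP: hf => hf; apply/eqaddoP => e e0.
  have h2 : \forall h \near 0, f (h + x) = g (h + x).
    by move: fg; rewrite (near_shift 0) /= subr0.
  apply: filterS2 (hf _ e0) h2 => h /=.
  rewrite /GRing.add /GRing.opp /= => + e2; rewrite -e2 -gx; exact.
by apply/diff_locallyP; rewrite (diff_unique dfc hg).
Qed.

Section Components.
Variables (R : realType) (n : nat).
Implicit Types (th : R) (f : Cn R n -> Cn R n) (x y z : 'rV[R[i]]_n) (k j l : 'I_n).

Lemma two_more_points th (p : R[i]) : exists s1 s2, [/\ ~ marked_lattice th s1,
  ~ marked_lattice th s2, s1 != s2, s1 != p & s2 != p].
Proof.
pose q (a : R) := Complex a (1 / 2).
have hq a : ~ marked_lattice th (q a).
  by move=> h; apply: (@lattice_point_domain R 1 th a ord0); rewrite mxE.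
have qq a b : a != b -> q a != q b.
  by apply: contraNneq => e; have /(congr1 (@complex.Re R)) := e => /= ->.
have q01 : q 0 != q 1 by apply: qq; rewrite eq_sym oner_eq0.
have q02 : q 0 != q 2 by apply: qq; rewrite eq_sym pnatr_eq0.
have q12 : q 1 != q 2 by apply: qq; rewrite lt_eqF// ltr1n.
have [e0|n0] := eqVneq (q 0) p.
  by exists (q 1), (q 2); split => //; rewrite -e0 eq_sym.
have [e1|n1] := eqVneq (q 1) p; last by exists (q 0), (q 1).
by exists (q 0), (q 2); split => //; rewrite -e1 eq_sym.
Qed.

Lemma component_slice th th' f z k j :
  holomorphic_on (lattice_domain th) f -> maps_into (lattice_domain th) (lattice_domain th') f ->
  lattice_domain th z ->
  (forall s, ~ marked_lattice th s -> cdiff (fun s => (f (row_set z k s) : 'rV[R[i]]_n) ord0 j) s) /\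
  (forall s, ~ marked_lattice th s -> ~ marked_lattice th' ((f (row_set z k s) : 'rV[R[i]]_n) ord0 j)).
Proof.
move=> hf mf hz; split => s hs; last by apply: mf; exact: row_set_domain.
by apply: slice_cdiff; apply: hf; exact: row_set_domain.
Qed.

Lemma component_constant th f j x y : lattice_domain th x -> lattice_domain th y ->
  (forall z k, lattice_domain th z -> exists c, forall s, ~ marked_lattice th s ->
    (f (row_set z k s) : 'rV[R[i]]_n) ord0 j = c) ->
  (f y : 'rV[R[i]]_n) ord0 j = (f x : 'rV[R[i]]_n) ord0 j.
Proof.
move=> hx hy hc.
apply: (@row_set_ind R n th (fun y => (f y : 'rV[R[i]]_n) ord0 j = (f x : 'rV[R[i]]_n) ord0 j) x y) => //.
move=> z k t hz ht <-; have [c hcz] := hc z k hz.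
by rewrite (hcz _ ht) -[in RHS](row_set_id z k) hcz//; exact: hz.
Qed.

(** On every coordinate line the component is the identity or constant. One identity line in
    direction [k] forces all parallel lines to be identity lines. *)
Lemma self_map_components th f j : int_independent th -> 1 / 4 <= th <= 3 / 4 ->
  in_E (lattice_domain th) f ->
  (exists k, forall z, lattice_domain th z -> (f z : 'rV[R[i]]_n) ord0 j = z ord0 k) \/
  (exists c, forall z, lattice_domain th z -> (f z : 'rV[R[i]]_n) ord0 j = c).
Proof.
move=> ith hth [hf mf].
have slice z k (hz : lattice_domain th z) :=
  let: conj s1 s2 := component_slice k j hf mf hz in self_map_marked_lattice ith hth s1 s2.
have [[x [k [hx hid]]]|hno] := pselect (exists z k, lattice_domain th z /\
    forall s, ~ marked_lattice th s -> (f (row_set z k s) : 'rV[R[i]]_n) ord0 j = s); last first.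
  right; exists ((f (lattice_point n 0) : 'rV[R[i]]_n) ord0 j) => z hz.
  apply: component_constant hz _; first exact: lattice_point_domain.
  move=> w k hw; have [h|//] := slice w k hw.
  by case: hno; exists w, k.
left; exists k => y hy; rewrite -{1}[y](row_set_id _ k); move: (y ord0 k) (hy k).
apply: (@row_set_ind R n th (fun y => forall s, ~ marked_lattice th s ->
  (f (row_set y k s) : 'rV[R[i]]_n) ord0 j = s) x y) => // z l t hz ht hzid.
have [->|lk] := eqVneq l k.
  move=> s hs; have -> : row_set (row_set z k t) k s = row_set z k s.
    by apply/rowP => i; rewrite !mxE; case: (i == k).
  exact: hzid.
have hzt : lattice_domain th (row_set z l t) by exact: row_set_domain.
have [//|[c hc]] := slice _ k hzt.
(* Over coordinate [k] equal to [s], the component along [l] takes the value [s] at [z ord0 l], so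
   it is the identity only if [s = z ord0 l]. Otherwise it is constant, and [c = s], which cannot
   hold for two values of [s]. *)
have off s : ~ marked_lattice th s -> s != z ord0 l -> c = s.
  move=> hs sz; rewrite -(hc s hs) -row_set_comm//.
  have hzs : lattice_domain th (row_set z k s) by exact: row_set_domain.
  have at_l : (f (row_set (row_set z k s) l (z ord0 l)) : 'rV[R[i]]_n) ord0 j = s.
    by rewrite -[X in row_set _ l X](row_set_diff z s lk) row_set_id hzid.
  have [h|[c' h]] := slice _ l hzs.
    by case/eqP: sz; rewrite -at_l h//; exact: hz.
  by rewrite h// -(h _ (hz l)).
have [s1 [s2 [h1 h2 h12 z1 z2]]] := two_more_points th (z ord0 l).
by case/eqP: h12; rewrite -(off _ h1 z1) -(off _ h2 z2).
Qed.

Lemma map_to_double_constant th f x y : int_independent th -> 1 / 4 <= th <= 3 / 8 ->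
  holomorphic_on (lattice_domain th) f ->
  maps_into (lattice_domain th) (lattice_domain (2 * th)) f ->
  lattice_domain th x -> lattice_domain th y -> f y = f x.
Proof.
move=> ith hth hf mf hx hy; apply/rowP => j; apply: component_constant hx hy _ => z k hz.
have [s1 s2] := component_slice k j hf mf hz.
exact: map_marked_lattice_double ith hth s1 s2.
Qed.

Lemma lattice_point_inj a b : (0 < n)%N -> lattice_point n a = lattice_point n b :> 'rV[R[i]]_n -> a = b.
Proof. by move=> n0 /rowP/(_ (Ordinal n0)); rewrite !mxE => -[]. Qed.

Lemma conjv_lattice_domain th z : lattice_domain th z -> lattice_domain th (conjv z : 'rV[R[i]]_n).
Proof.
move=> hz j; rewrite mxE; case: (z ord0 j) (hz j) => a b hab [[k [l [ak bl]]]|[ath b0]]; apply: hab.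
  by left; exists k, (- l); rewrite intrN -ak -bl opprK.
by right; rewrite ath -[b]opprK b0 oppr0.
Qed.

Lemma conjvK (z : Cn R n) : conjv (conjv z) = z.
Proof. by apply/rowP => j; rewrite !mxE conjCK. Qed.

End Components.

(** * Conjugation by the exchange of the two extra points *)

Section Exchange.
Variables (R : realType) (n : nat).
Implicit Types (th u v : R) (f : Cn R n -> Cn R n) (s : R[i]).

(** A transposition: it fixes the Gaussian integers when both points are irrational, and as an
    involution it serves for both directions of the isomorphism. *)
Definition exchange u v s : R[i] :=
  if s == (u%:C)%C then (v%:C)%C else if s == (v%:C)%C then (u%:C)%C else s.

Lemma exchangeK u v : involutive (exchange u v).
Proof.
move=> s; rewrite /exchange; case: (eqVneq s (u%:C)%C) => [->|su].
  by rewrite eqxx; case: eqVneq => [->|].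
case: (eqVneq s (v%:C)%C) => [->|sv]; first by rewrite eqxx.
by rewrite (negbTE su) (negbTE sv).
Qed.

Lemma exchange_marked_lattice u v s : int_independent u -> int_independent v ->
  ~ marked_lattice u s -> ~ marked_lattice v (exchange u v s).
Proof.
move=> iu iv hs; rewrite /exchange; case: eqVneq => [e|su]; first by case: hs; right.
case: eqVneq => [e|sv] [h|h].
- exact: not_gaussian iu h.
- by case/eqP: su; rewrite e -h.
- by apply: hs; left.
- by case/eqP: sv.
Qed.

Lemma exchangeC u v : exchange u v =1 exchange v u.
Proof.
move=> s; rewrite /exchange; case: (eqVneq s (u%:C)%C) => [->|//].
by case: eqVneq => [->|].
Qed.

Definition exchangev u v (z : Cn R n) : Cn R n := map_mx (exchange u v) z.

Lemma exchangevK u v : involutive (exchangev u v).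
Proof. by move=> z; apply/rowP => j; rewrite !mxE exchangeK. Qed.

Lemma exchangevC u v : exchangev u v =1 exchangev v u.
Proof. by move=> z; apply/rowP => j; rewrite !mxE exchangeC. Qed.

Lemma exchangev_domain u v z : int_independent u -> int_independent v ->
  lattice_domain u z -> lattice_domain v (exchangev u v z).
Proof. by move=> iu iv hz j; rewrite mxE; exact: exchange_marked_lattice. Qed.

(** The exchange is discontinuous, so holomorphy is not inherited; it comes from the classification,
    as conjugation fixes coordinate functions and permutes constants. *)
Lemma exchange_conj_in_E u v f : int_independent u -> int_independent v ->
  1 / 4 <= u <= 3 / 4 -> 1 / 4 <= v <= 3 / 4 -> in_E (lattice_domain u) f ->
  in_E (lattice_domain v) (exchangev u v \o f \o exchangev u v).
Proof.
move=> iu iv hu hv hf.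
have to_u z : lattice_domain v z -> lattice_domain u (exchangev u v z).
  by rewrite exchangevC; exact: exchangev_domain.
have mg : maps_into (lattice_domain v) (lattice_domain v) (exchangev u v \o f \o exchangev u v).
  by move=> z /to_u hz; apply: exchangev_domain => //; exact: hf.2.
split => // w hw.
have comp (j : 'I_n) : exists l : Cn R n -> cfield R, (forall z, differentiable l z) /\
    (forall z, lattice_domain v z ->
      ((exchangev u v \o f \o exchangev u v) z : 'rV[R[i]]_n) ord0 j = l z).
  have [[k hk]|[c hc]] := self_map_components j iu hu hf.
    exists (fun z : 'rV[cfield R]_n => z ord0 k); split => [z|z /to_u hz].
      exact: differentiable_coord.
    by rewrite /= mxE hk// mxE exchangeK.
  exists (cst (exchange u v c)); split => [z|z /to_u hz]; first exact: differentiable_cst.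
  by rewrite /= mxE hc.
have [l hl] := choice comp.
(* A globally differentiable map, assembled from coordinates and constants, that agrees with the
   conjugate on the domain. *)
pose g (z : Cn R n) : Cn R n := \sum_(j < n) (l j z *: (delta_mx ord0 j : 'rV[cfield R]_n)).
have hg z : lattice_domain v z -> g z = (exchangev u v \o f \o exchangev u v) z.
  move=> hz; rewrite [RHS]row_sum_delta; apply: eq_bigr => j _.
  by rewrite (hl j).2.
apply: (@near_eq_differentiable (cfield R) (Cn R n) (Cn R n) g).
  have := lattice_domain_open (n := n) hv; rewrite openE => /(_ w hw).
  by apply: filterS => z; exact: hg.
rewrite /g (_ : (fun z => _) = \sum_(j < n) (fun z => l j z *: (delta_mx ord0 j : 'rV[cfield R]_n))); last first.
  by apply/funext => z; rewrite fct_sumE.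
apply: (@differentiable_sum (cfield R) (Cn R n) (Cn R n)) => j.
by apply: differentiableZl; exact: (hl j).1.
Qed.

Lemma E_isomorphic_lattice_domain u v : int_independent u -> int_independent v ->
  1 / 4 <= u <= 3 / 4 -> 1 / 4 <= v <= 3 / 4 ->
  E_isomorphic (lattice_domain u : set (Cn R n)) (lattice_domain v).
Proof.
move=> iu iv hu hv; pose X := exchangev u v.
have XX : involutive X by exact: exchangevK.
have to_v z : lattice_domain u z -> lattice_domain v (X z) by exact: exchangev_domain.
have to_u z : lattice_domain v z -> lattice_domain u (X z).
  by rewrite /X exchangevC; exact: exchangev_domain.
exists (fun f => X \o f \o X); split.
- by move=> f; exact: exchange_conj_in_E.
- by move=> f g _ _ fg w /to_u hw /=; rewrite fg.
- by move=> f g _ _ w _ /=; rewrite XX.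
- move=> f g _ _ fg z /to_v hz; have := fg _ hz; rewrite /= !XX.
  exact: (can_inj XX).
- move=> h hh; exists (X \o h \o X).
    have := exchange_conj_in_E iv iu hv hu hh; rewrite /X.
    by congr in_E; apply/funext => z /=; rewrite !(exchangevC v u).
  by move=> w _ /=; rewrite !XX.
Qed.

End Exchange.

Theorem theorem3 (R : realType) (n : nat) (hn : (0 < n)%N) :
  exists D1 D2 : set (Cn R n),
    [/\ is_domain D1 /\ is_domain D2, unbounded D1 /\ unbounded D2,
        E_isomorphic D1 D2,
        (forall F, ~ biholomorphic D1 D2 F)
      & (forall F, ~ antibiholomorphic D1 D2 F)].
Proof.
have [th ith hth] := exists_int_independent R.
have [th1 th2] := andP hth.
have h1 : 1 / 4 <= th <= 3 / 4 by apply/andP; split; lra.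
have h2 : 1 / 4 <= 2 * th <= 3 / 4 by apply/andP; split; lra.
have i2 := int_independent_double ith.
have p0 := @lattice_point_domain R n th 0; have p1 := @lattice_point_domain R n th 1.
have p01 : lattice_point n (0 : R) <> lattice_point n 1.
  by move=> /(lattice_point_inj hn)/eqP; rewrite eq_sym oner_eq0.
exists (lattice_domain th), (lattice_domain (2 * th)); split.
- by split; exact: lattice_domain_is_domain.
- by split; exact: lattice_domain_unbounded.
- exact: E_isomorphic_lattice_domain.
(* [F] is constant, so its left inverse [G] would identify two distinct points. *)
- move=> F [hF [mF [G [_ _ GF _]]]]; apply: p01.
  rewrite -[LHS](GF _ p0) -[RHS](GF _ p1); congr G.
  exact: map_to_double_constant ith hth hF mF p1 p0.
- move=> F [hF [mF [G [_ _ GF _]]]]; apply: p01.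
  rewrite -[LHS](GF _ p0) -[RHS](GF _ p1); congr G.
  (* The target is invariant under conjugation, so [conjv \o F] is a holomorphic map into it and is
     constant as before. *)
  apply: (can_inj (@conjvK R n)).
  apply: (map_to_double_constant ith hth hF _ p1 p0) => z hz /=.
  exact: conjv_lattice_domain (mF _ hz).
Qed.
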